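(* For every planar convex body $K\subset\mathbb R^2$, $$\mathbb E|X_1-X_2|^2\le \mathbb E|B_1-B_2|^2,$$ where $X_1,X_2$ are independent and uniform in $K$, and $B_1,B_2$ are independent and uniform on $\partial K$.
   Context: A convex body is a compact convex set with nonempty interior. Uniform in $K$ means distributed according to normalized Lebesgue (area) measure on $K$; uniform on $\partial K$ means distributed according to normalized arclength measure on $\partial K$. $|\cdot|$ is the Euclidean norm. *)

(* Defs.v *)
From HB Require Import structures.
From mathcomp Require Import all_boot all_order all_algebra.
From mathcomp Require Import all_classical all_reals all_analysis.

Set Implicit Arguments.
Unset Strict Implicit.
Unset Printing Implicit Defensive.

Import Order.TTheory GRing.Theory Num.Theory.
Import numFieldNormedType.Exports.

Local Open Scope classical_set_scope.
Local Open Scope ring_scope.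

(* The canonical norm of R * R is the maximum norm, so the Euclidean norm is
   written out; both induce the same topology. *)
Definition enorm {R : realType} (x : R * R) : R :=
  Num.sqrt (x.1 ^+ 2 + x.2 ^+ 2).

Definition boundary {T : topologicalType} (A : set T) : set T :=
  closure A `\` interior A.

Definition convex_body {R : realType} (K : set (R * R)) : Prop :=
  [/\ compact K, convex_set (K : set (R^o * R^o)) & interior K !=set0].

Definition area {R : realType} : set (R * R) -> \bar R :=
  (@lebesgue_measure R \x @lebesgue_measure R)%E.

(* The value 0%E is joined in because the supremum of the empty set is -oo. *)
Definition diam {R : realType} (U : set (R * R)) : \bar R :=
  maxe 0%E (ereal_sup [set (enorm (p.1 - p.2))%:E | p in U `*` U]).

Definition hausdorff1_pre {R : realType} (e : R) (A : set (R * R)) : \bar R :=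
  ereal_inf [set (\sum_(0 <= i <oo) diam (U i))%E |
    U in [set U : (set (R * R))^nat |
      A `<=` \bigcup_i U i /\ forall i, (diam (U i) <= e%:E)%E]].

(* Arclength on a rectifiable curve is one-dimensional Hausdorff measure; with
   this normalization a segment is assigned its Euclidean length. *)
Definition arclength {R : realType} (A : set (R * R)) : \bar R :=
  ereal_sup [set hausdorff1_pre e A | e in [set e : R | 0 < e]].

Definition uniform_on {d} {T : measurableType d} {R : realType}
    (P : probability T R) (mu : set (R * R) -> \bar R) (D : set (R * R))
    (X : {RV P >-> (R * R)%type}) : Prop :=
  forall A : set (R * R), measurable A ->
    distribution P X A = (mu (A `&` D) / mu D)%E.

Definition independent {d d1 d2} {T : measurableType d}
    {T1 : measurableType d1} {T2 : measurableType d2} {R : realType}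
    (P : probability T R) (X : {RV P >-> T1}) (Y : {RV P >-> T2}) : Prop :=
  forall (A : set T1) (B : set T2), measurable A -> measurable B ->
    P (X @^-1` A `&` Y @^-1` B) = (P (X @^-1` A) * P (Y @^-1` B))%E.

(* Main.v *)
Require Import Defs.
From HB Require Import structures.
From mathcomp Require Import all_boot all_order all_algebra.
From mathcomp Require Import all_classical all_reals all_analysis.
From mathcomp Require Import measurable_realfun ring lra.

(** Expanding the square, the mean of |X1 - X2|^2 for two independent copies of
    a random point is twice its variance, the mean squared distance to its mean
    point ([expectation_sqdist]).  So the claim is that the variance V of a
    uniform point of K is at most that of a uniform point of the boundary.

    Chords in one direction.  Foliate K by the lines x - tau * y = s, with s in
    an interval I, and let a linear form u take the values U(s) and W(s) at the
    two ends of the chord of level s.  Up to the same factor, which depends only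
    on the slope of u along the chords, the area of K is the integral over I of
    U - W, and the second moment of u - c over K is a third of the integral of
    (U - c)^3 - (W - c)^3.  One of U and W is concave and the other convex.  A
    concave function on an interval is negatively skewed: if s is the function
    less its mean and S the primitive of s that vanishes at both ends, two
    integrations by parts turn the integral of s^3 into that of s'' * S^2
    ([concave_third_moment]; the computation is done on sequences, in
    [sum_cube_concave_seq], and passes to the limit).  With c half-way between
    the means of U and W this bounds the variance of u over K by the mean square
    of u - c at the ends of the chords, averaged over s in I
    ([chord_variance_le]).  Adding the two coordinates,

      2 * |I| * V <= integral over I of F (one end) + F (other end),

    where F is the squared distance to any fixed point ([direction_variance]).

    Averaging over directions.  The Euclidean norm of z is within a factor 1 + e
    of a finite sum of rho_k * |z.1 - tau_k * z.2| with all tau_k nonzero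
    ([euclidean_norm_zonotope]).  Let ds_k be the measure on the boundary carried
    by the ends of the chords of slope index k.  The ds_k-measure of an arc is
    at least the level difference of its ends, and its length is at least that
    of its chord ([chord_measure_arc_ge], [arclength_arc_ge]).  Cut the boundary
    into small arcs with marked points p_j.  The total mass of ds_k is twice the
    width |I_k|, and so is, nearly, the sum of the level differences of
    consecutive p_j; so the integral of F for ds_k is nearly the sum of
    F(p_j) times the level difference from p_j to p_(j+1)
    ([end_sum_le_polygon]).  Covering the boundary by these small arcs also
    bounds its length L by 1 + e times the sum of rho_k * 2 * |I_k|
    ([arclength_boundary_le], half of Cauchy's perimeter formula).  Altogether,
    with F the squared distance to the mean point of the boundary, and up to
    terms that vanish with the size of the arcs,

      L * V <= (1 + e) * sum_k rho_k * 2 * |I_k| * V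
            <= (1 + e) * sum_k rho_k * sum_j F(p_j) * |level difference|
            <= (1 + e) * sum_j F(p_j) * |p_(j+1) - p_j|
            <= (1 + e) * integral of F over the boundary for arclength,

    and the last integral is L times the variance of a uniform point of the
    boundary ([boundary_variance_ge]).  That L and the area are finite and
    positive is implied by the existence of uniform points. *)

Set Implicit Arguments.
Unset Strict Implicit.
Unset Printing Implicit Defensive.

Import Order.TTheory GRing.Theory Num.Theory.
Import numFieldNormedType.Exports.

Local Open Scope classical_set_scope.
Local Open Scope ring_scope.

(** * Concave sequences *)

Section concave_sequences.
Context {R : realType}.
Implicit Types (s : nat -> R) (n : nat) (M C : R).

Definition concave_seq s n :=
  forall i, (i.+2 <= n)%N -> s i + s i.+2 <= 2 * s i.+1.

Lemma concave_seq_le s n i j : concave_seq s n -> (i <= j)%N -> (j.+1 <= n)%N ->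
  s j.+1 - s j <= s i.+1 - s i.
Proof.
move=> cs; elim: j => [|j IH] ij jn; first by move: ij; rewrite leqn0 => /eqP ->.
move: ij; rewrite leq_eqVlt => /predU1P[->//|ij].
by have := IH ij (ltnW jn); have := cs j jn; lra.
Qed.

(** Summation by parts, twice, by induction on the length.  With S the partial sums
    of s, the continuous model is that s^3 and s'' * S^2 have the same integral up
    to end terms.  Here S^2 becomes a product of two consecutive partial sums; it is
    the square of their half-sum less a quarter of the square of the term between
    them, hence at least - M^2 / 4, and the corrections M^2 / 4 telescope. *)
Lemma sum_cube_concave_seq s n M :
  (forall i, (i <= n.+1)%N -> `|s i| <= M) -> concave_seq s n.+1 ->
  \sum_(i < n.+2) s i ^+ 3 <=
    s n.+1 ^+ 2 * \sum_(i < n.+2) s i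
    - (s n.+1 - s n) * ((\sum_(i < n.+1) s i) * (\sum_(i < n.+2) s i))
    + M ^+ 2 / 4 * ((s 1%N - s 0%N) - (s n.+1 - s n)).
Proof.
elim: n => [|n IH] sM cs; first by rewrite !big_ord_recr !big_ord0 /=; lra.
have E k (f : nat -> R) : \sum_(i < k.+1) f i = \sum_(i < k) f i + f k.
  by rewrite big_ord_recr.
have {IH} := IH (fun i h => sM i (leqW h)) (fun i h => cs i (leqW h)).
rewrite !(E _ s) !(E _ (fun i => s i ^+ 3)) => IH.
have d_le := cs n (leqnn _).
have M0 : 0 <= M by apply: le_trans (sM 0%N _).
have qM : s n.+1 ^+ 2 <= M ^+ 2.
  by rewrite -[s _ ^+ 2]real_normK ?num_real// lerXn2r ?nnegrE// sM.
move: IH; move: (\sum_(i < n) s i ^+ 3) (\sum_(i < n) s i) => T S.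
move: (s n.+2) (s n.+1) (s n) (s 1%N) (s 0%N) (M ^+ 2) d_le qM => z y x b a q d_le qM IH.
have sq := sqr_ge0 (S + x + y / 2).
have : 0 <= ((y - x) - (z - y)) * ((S + x + y) * (S + x) + q / 4).
  by apply: mulr_ge0; nra.
lra.
Qed.

(** The bound does not depend on the length of the sequence, so it disappears from
    the mean in the limit. *)
Lemma concave_seq_sum_cube_le s n M :
  (forall i, (i <= n)%N -> `|s i| <= M) -> concave_seq s n ->
  \sum_(i < n.+1) s i = 0 -> \sum_(i < n.+1) s i ^+ 3 <= M ^+ 3.
Proof.
case: n => [|n] sM cs s0.
  move: s0; rewrite !big_ord_recr !big_ord0 /= !add0r => ->.
  by rewrite expr0n/= exprn_ge0// (le_trans _ (sM 0%N _)).
apply: le_trans (sum_cube_concave_seq sM cs) _; rewrite s0 !mulr0 subr0 add0r.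
have := sM 0%N isT; have := sM 1%N isT; have := sM n (leqnSn n); have := sM n.+1 (leqnn _).
rewrite !ler_norml => /andP[? ?] /andP[? ?] /andP[? ?] /andP[? ?].
have M2 : 0 <= M ^+ 2 by exact: sqr_ge0.
have : 0 <= M ^+ 2 * (4 * M - (s 1%N - s 0%N - (s n.+1 - s n))) by apply: mulr_ge0 => //; lra.
rewrite [M ^+ 3]exprS; lra.
Qed.

(** A concave sequence rises to its maximum and then falls, so its variation is
    the sum of the differences of its maximum and its two ends. *)
Lemma concave_seq_variation s n C :
  (forall i, (i <= n)%N -> s i <= C) -> concave_seq s n ->
  \sum_(i < n) `|s i.+1 - s i| <= 2 * C - s 0%N - s n.
Proof.
elim: n => [|n IH] sC cs; first by rewrite big_ord0; have := sC 0%N isT; lra.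
rewrite big_ord_recr /=.
have [dn|dn] := leP 0 (s n.+1 - s n).
  have -> : \sum_(i < n) `|s i.+1 - s i| = s n - s 0%N.
    rewrite -(telescope_sumr _ (leq0n n)) big_mkord; apply: eq_bigr => i _.
    rewrite ger0_norm//; apply: le_trans dn _.
    by apply: (concave_seq_le cs) => //; exact: ltnW.
  by rewrite ger0_norm//; have := sC n.+1 (leqnn _); lra.
have := IH (fun i h => sC i (leqW h)) (fun i h => cs i (leqW h)).
by rewrite (ltr0_norm dn); lra.
Qed.
End concave_sequences.

(** * The Euclidean norm as a limit of zonotope norms *)

Section half_circle.
Context {R : realType}.
Implicit Types (a b c x y : R) (z : R * R).

Definition arc_height x : R := Num.sqrt (1 - x ^+ 2).

Lemma arc_height_ge0 x : 0 <= arc_height x.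
Proof. exact: sqrtr_ge0. Qed.

Lemma sqr_arc_height x : `|x| <= 1 -> arc_height x ^+ 2 = 1 - x ^+ 2.
Proof.
move=> x1; rewrite sqr_sqrtr// subr_ge0 -[x ^+ 2]real_normK ?num_real//.
by rewrite expr_le1.
Qed.

Lemma arc_height_concave a b : `|a| <= 1 -> `|b| <= 1 ->
  arc_height a + arc_height b <= 2 * arc_height ((a + b) / 2).
Proof.
move=> a1 b1.
have c1 : `|(a + b) / 2| <= 1.
  by rewrite normrM (ger0_norm (x := 2^-1))//; have := ler_normD a b; lra.
rewrite -(@ler_pXn2r _ 2)// ?nnegrE ?addr_ge0 ?mulr_ge0 ?arc_height_ge0//.
rewrite exprMn sqr_arc_height// sqrrD !sqr_arc_height//.
suff : arc_height a * arc_height b <= 1 - a * b by lra.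
have ab1 : a * b <= 1.
  by apply: le_trans (ler_norm _) _; rewrite normrM mulr_ile1.
rewrite -(@ler_pXn2r _ 2)// ?nnegrE ?mulr_ge0 ?arc_height_ge0 ?subr_ge0//.
by rewrite exprMn !sqr_arc_height//; have := sqr_ge0 (a - b); lra.
Qed.

Lemma enorm_ge0 z : 0 <= enorm z. Proof. exact: sqrtr_ge0. Qed.

Lemma sqr_enorm z : enorm z ^+ 2 = z.1 ^+ 2 + z.2 ^+ 2.
Proof. by rewrite sqr_sqrtr// addr_ge0// sqr_ge0. Qed.

Lemma dot_arc_le z x : `|x| <= 1 -> z.1 * x + z.2 * arc_height x <= enorm z.
Proof.
move=> x1; have [h|/ltW h] := leP (z.1 * x + z.2 * arc_height x) 0.
  exact: le_trans (enorm_ge0 _).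
rewrite -(@ler_pXn2r _ 2)// ?nnegrE ?enorm_ge0// sqr_enorm.
have := sqr_arc_height x1; have := sqr_ge0 (z.1 * arc_height x - z.2 * x).
move: (arc_height x) => w; move: z.1 z.2 => u v sq w2.
have -> : u ^+ 2 + v ^+ 2 = (u ^+ 2 + v ^+ 2) * (x ^+ 2 + w ^+ 2).
  by rewrite w2 addrCA subrr addr0 mulr1.
by move: sq; lra.
Qed.

(** Equidistant abscissas in [-1, 1].  The points of the unit half-circle above
    them are the vertices of a polygonal line whose edges give the directions of the
    zonotope. *)
Definition grid_pt N i : R := i%:R / N%:R - 1.

Lemma grid_pt_norm N i : (0 < N)%N -> (i <= N.*2)%N -> `|grid_pt N i| <= 1.
Proof.
move=> N0 iN; rewrite /grid_pt ler_norml.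
have : 0 <= i%:R / N%:R :> R by rewrite divr_ge0.
have : i%:R / N%:R <= 2 :> R.
  by rewrite ler_pdivrMr ?ltr0n// -natrM mul2n ler_nat.
by move=> ? ?; apply/andP; split; lra.
Qed.

(** Along an edge of that polygonal line this scalar product grows by
    (z.1 - tau * z.2) / N, where - tau is the slope of the edge. *)
Definition grid_dot N z i : R := z.1 * grid_pt N i + z.2 * arc_height (grid_pt N i).

Lemma grid_dot_concave N z : (0 < N)%N -> 0 <= z.2 ->
  concave_seq (grid_dot N z) N.*2.
Proof.
move=> N0 z2 i iN; rewrite /grid_dot.
have h := arc_height_concave (grid_pt_norm N0 (ltnW (ltnW iN))) (grid_pt_norm N0 iN).
have E : (grid_pt N i + grid_pt N i.+2) / 2 = grid_pt N i.+1.
  by rewrite /grid_pt -[i.+2]addn2 -[i.+1]addn1 !natrD; field; rewrite pnatr_eq0 -lt0n.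
rewrite E in h; have : 0 <= z.2 * (2 * arc_height (grid_pt N i.+1) - (arc_height (grid_pt N i) + arc_height (grid_pt N i.+2))).
  by rewrite mulr_ge0// subr_ge0.
by move: E => /(congr1 (fun t => 2 * t)); rewrite mulrCA divff// mulr1 => E;
   have := congr1 (fun t => z.1 * t) E => /=; lra.
Qed.

Lemma grid_dot_ends N z : (0 < N)%N ->
  grid_dot N z 0 = - z.1 /\ grid_dot N z N.*2 = z.1.
Proof.
move=> N0; have NN : N%:R != 0 :> R by rewrite pnatr_eq0 -lt0n.
have -> : grid_dot N z 0 = - z.1.
  rewrite /grid_dot /grid_pt mul0r sub0r /arc_height sqrrN expr1n subrr sqrtr0.
  by rewrite mulr0 addr0 mulrN1.
have -> : grid_dot N z N.*2 = z.1.
  rewrite /grid_dot /grid_pt -mul2n natrM mulfK//.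
  have -> : (2 - 1 : R) = 1 by lra.
  by rewrite /arc_height expr1n subrr sqrtr0 mulr0 addr0 mulr1.
by [].
Qed.

(** Crofton's formula for a segment, on finitely many directions: the scalar
    products of z with the points of a half-circle are concave, run from - z.1 to
    z.1, and do not exceed the norm of z. *)
Lemma grid_variation_le N z : (0 < N)%N ->
  \sum_(i < N.*2) `|grid_dot N z i.+1 - grid_dot N z i| <= 2 * enorm z.
Proof.
(* replacing z by its opposite changes neither side *)
move=> N0; wlog z2 : z / 0 <= z.2.
  move=> H; have [/H//|z2] := leP 0 z.2.
  have /H : 0 <= (- z).2 by rewrite /= oppr_ge0 ltW.
  rewrite /enorm/= !sqrrN; apply: le_trans.
  rewrite le_eqVlt; apply/orP; left; apply/eqP; apply: eq_bigr => i _.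
  by rewrite -normrN; congr `|_|; rewrite /grid_dot /=; ring.
have [E0 E1] := grid_dot_ends z N0.
have := concave_seq_variation (C := enorm z) _ (grid_dot_concave N0 z2).
rewrite E0 E1 opprK => -/(_ _)/le_trans; apply; last by lra.
by move=> i iN; apply: dot_arc_le; exact: grid_pt_norm.
Qed.

(** The sequence goes from - z.1 to its value at i and from there to z.1; the
    contributions of the two ends cancel. *)
Lemma grid_variation_ge N z i : (0 < N)%N -> (i <= N.*2)%N ->
  2 * grid_dot N z i <= \sum_(j < N.*2) `|grid_dot N z j.+1 - grid_dot N z j|.
Proof.
move=> N0 iN; have [E0 E1] := grid_dot_ends z N0.
rewrite -(big_mkord predT (fun j => `|grid_dot N z j.+1 - grid_dot N z j|)).
rewrite (big_cat_nat (n := i))//=.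
have A m n : (m <= n)%N -> `|grid_dot N z n - grid_dot N z m| <= \sum_(m <= j < n) `|grid_dot N z j.+1 - grid_dot N z j|.
  by move=> mn; rewrite -(telescope_sumr _ mn); exact: ler_norm_sum.
have := A _ _ (leq0n i); have := A _ _ iN; rewrite E0 E1.
have := ler_norm (grid_dot N z i - - z.1);
have := ler_norm (- (z.1 - grid_dot N z i)); rewrite normrN.
by lra.
Qed.

(** Round the abscissa of z / |z| towards 0 to a grid point: the half-circle is not
    lower there, so only the abscissa loses, and at most 1 / N. *)
Lemma grid_dot_ge N z : (0 < N)%N -> 0 <= z.2 ->
  exists2 i, (i <= N.*2)%N & enorm z * (1 - N%:R^-1) <= grid_dot N z i.
Proof.
move=> N0 z2; have [n0|n0] := eqVneq (enorm z) 0.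
  exists 0%N => //; have [-> _] := grid_dot_ends z N0; rewrite n0 mul0r.
  have := sqr_enorm z; rewrite n0 expr0n/=.
  by have := sqr_ge0 z.1; have := sqr_ge0 z.2; nra.
have npos : 0 < enorm z by rewrite lt_neqAle eq_sym n0 enorm_ge0.
have NR : 0 < N%:R :> R by rewrite ltr0n.
pose m := Num.trunc (`|z.1| * N%:R / enorm z).
have zn : `|z.1| <= enorm z.
  rewrite -(@ler_pXn2r _ 2)// ?nnegrE ?enorm_ge0// sqr_enorm real_normK ?num_real//.
  by rewrite lerDl sqr_ge0.
have /andP[m_le m_gt] : (m%:R <= `|z.1| * N%:R / enorm z < m.+1%:R).
  by apply: truncn_itv; rewrite divr_ge0 ?mulr_ge0 ?enorm_ge0.
have mN : (m <= N)%N.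
  rewrite -(ler_nat R); apply: le_trans m_le _.
  by rewrite ler_pdivrMr// mulrC ler_wpM2l.
pose i := if 0 <= z.1 then (N + m)%N else (N - m)%N.
have iN : (i <= N.*2)%N by rewrite /i -addnn; case: ifP => _; [rewrite leq_add2l|rewrite (leq_trans (leq_subr _ _))// leq_addr].
exists i => //.
have xi : grid_pt N i = (if 0 <= z.1 then 1 else -1) * (m%:R / N%:R).
  rewrite /grid_pt /i; case: ifP => _; first by rewrite natrD; field; rewrite gt_eqF.
  by rewrite natrB//; field; rewrite gt_eqF.
have zxi : z.1 * grid_pt N i = `|z.1| * (m%:R / N%:R).
  rewrite xi mulrA; congr (_ * _); case: ifPn => [h|]; first by rewrite mulr1 ger0_norm.
  by rewrite -ltNge => h; rewrite mulrN1 ltr0_norm.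
have xi2 : grid_pt N i ^+ 2 = (m%:R / N%:R) ^+ 2.
  by rewrite xi exprMn; case: ifP => _; rewrite ?sqrrN expr1n mul1r.
have mle : m%:R / N%:R <= `|z.1| / enorm z.
  by rewrite ler_pdivrMr// mulrAC.
have mge : `|z.1| / enorm z - N%:R^-1 <= m%:R / N%:R.
  rewrite lerBlDr -[X in _ <= _ + X]div1r -mulrDl ler_pdivlMr// mulrAC natr1.
  exact: ltW.
have hge : z.2 / enorm z <= arc_height (grid_pt N i).
  rewrite -(@ler_pXn2r _ 2)// ?nnegrE ?arc_height_ge0 ?divr_ge0 ?enorm_ge0//.
  rewrite sqr_arc_height ?grid_pt_norm// xi2.
  have : (m%:R / N%:R) ^+ 2 <= (`|z.1| / enorm z) ^+ 2.
    by rewrite ler_pXn2r// ?nnegrE ?divr_ge0 ?enorm_ge0.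
  rewrite !exprMn real_normK ?num_real//.
  have := sqr_enorm z => /(congr1 (fun t => t * enorm z ^-2)).
  by rewrite divff ?expf_neq0// mulrDl !exprVn; lra.
rewrite /grid_dot zxi.
have h1 : `|z.1| * (`|z.1| / enorm z - N%:R^-1) <= `|z.1| * (m%:R / N%:R) by apply: ler_wpM2l.
have h2 : z.2 * (z.2 / enorm z) <= z.2 * arc_height (grid_pt N i) by apply: ler_wpM2l.
have h3 : `|z.1| * N%:R^-1 <= enorm z * N%:R^-1 by apply: ler_wpM2r => //; rewrite invr_ge0 ltW.
have h4 : `|z.1| * (`|z.1| / enorm z) + z.2 * (z.2 / enorm z) = enorm z.
  rewrite !mulrA -mulrDl -!expr2 real_normK ?num_real// -sqr_enorm.
  by rewrite expr2 mulfK.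
by lra.
Qed.

(** Half the variation of the scalar products of z along the polygonal line lies
    between (1 - 1 / N) * |z| and |z|, and it is a sum of absolute values of linear
    forms, one for each edge.  The condition on tau k excludes vertical lines, on
    which the abscissa is constant and carries no information on the chords. *)
Lemma euclidean_norm_zonotope (e : R) : 0 < e ->
  exists N (rho tau : nat -> R),
    (forall k, (k < N)%N -> 0 < rho k /\ tau k != 0) /\
    forall z, let S := \sum_(k < N) rho k * `|z.1 - tau k * z.2| in
      S <= enorm z /\ enorm z <= (1 + e) * S.
Proof.
move=> e0.
(* this size gives (1 + e) (1 - 1 / N) >= 1 *)
pose N := (Num.trunc ((1 + e) / e)).+1.
have N0 : (0 < N)%N by [].
have NR : 0 < N%:R :> R by rewrite ltr0n.
have eN : (1 + e) * (1 - N%:R^-1) >= 1.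
  have : (1 + e) / e < N%:R by apply: truncnS_gt.
  rewrite ltr_pdivrMr// => /ltW h.
  rewrite -(ler_pM2r NR) mul1r -mulrA mulrBl mulVf ?gt_eqF// mul1r; lra.
exists N.*2, (fun _ => (2 * N%:R)^-1),
  (fun i => - N%:R * (arc_height (grid_pt N i.+1) - arc_height (grid_pt N i))).
split.
  (* 0 is one of the abscissas, so no edge joins two points of equal height *)
  move=> k kN; split; first by rewrite invr_gt0 mulr_gt0.
  apply: mulf_neq0; first by rewrite oppr_eq0 gt_eqF.
  rewrite subr_eq0; apply/eqP => h.
  have := congr1 (fun t => t ^+ 2) h.
  rewrite !sqr_arc_height ?grid_pt_norm ?(ltnW kN)// => /eqP.
  rewrite (inj_eq (addrI _)) eqr_opp eqf_sqr /grid_pt => /orP[/eqP|/eqP].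
    move=> /addIr /divIf -/(_ _); rewrite gt_eqF// => -/(_ isT) /eqP.
    by rewrite eqr_nat eqn_leq ltnn.
  move=> /(congr1 (fun t => t * N%:R)); rewrite mulNr !mulrBl !divfK ?gt_eqF// mul1r => E.
  have {}E : (k.+1 + k)%:R = (N.*2)%:R :> R.
    by rewrite -muln2 natrM natrD; lra.
  move/eqP: E; rewrite eqr_nat => /eqP/(congr1 odd).
  by rewrite odd_double addSn addnn /= odd_double.
move=> z /=.
set S := \sum_(k < _) _.
have SE : S = (\sum_(i < N.*2) `|grid_dot N z i.+1 - grid_dot N z i|) / 2.
  rewrite /S mulr_suml; apply: eq_bigr => i _.
  rewrite invfM -mulrA mulrC; congr (_ / 2).
  rewrite -[N%:R^-1]ger0_norm ?invr_ge0 ?ler0n// -normrM; congr `|_|.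
  by rewrite /grid_dot /grid_pt -[i.+1]addn1 natrD; field; rewrite gt_eqF.
split; first by rewrite SE ler_pdivrMr// mulrC; exact: grid_variation_le.
rewrite {}SE.
wlog z2 : z {S} / 0 <= z.2.
  move=> H; have [/H//|z2] := leP 0 z.2.
  have /H : 0 <= (- z).2 by rewrite /= oppr_ge0 ltW.
  rewrite /enorm/= !sqrrN => /le_trans; apply.
  rewrite le_eqVlt; apply/orP; left; apply/eqP; congr (_ * (_ / _)).
  apply: eq_bigr => i _.
  by rewrite -normrN; congr `|_|; rewrite /grid_dot /=; ring.
have [i iN hi] := grid_dot_ge N0 z2.
have hv := grid_variation_ge z N0 iN.
have h5 : enorm z * (1 - N%:R^-1) <= (\sum_(i < N.*2) `|grid_dot N z i.+1 - grid_dot N z i|) / 2 by lra.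
have h6 : enorm z * 1 <= enorm z * ((1 + e) * (1 - N%:R^-1)) by rewrite ler_wpM2l// enorm_ge0.
have h7 : (1 + e) * (enorm z * (1 - N%:R^-1)) <= (1 + e) * ((\sum_(i < N.*2) `|grid_dot N z i.+1 - grid_dot N z i|) / 2) by rewrite ler_wpM2l//; lra.
lra.
Qed.
End half_circle.

(** * Skewness of concave functions *)

Section segment_integrals.
Context {R : realType}.
Local Notation mu := (@lebesgue_measure R).
Implicit Types (a b c x y M : R) (f g : R -> R).

(** Heine's theorem, for continuity relative to a segment. *)
Lemma within_segment_unif f a b (e : R) : {within `[a, b], continuous f} -> 0 < e ->
  exists2 d : R, 0 < d & forall x y, `[a, b]%classic x -> `[a, b]%classic y ->
    `|x - y| < d -> `|f x - f y| < e.
Proof.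
move=> /subspace_continuousP cf e0.
have /compact_near_coveringP/near_covering_withinP cov := @segment_compact R a b.
have := cov R 0^'+ (fun d x => forall y, `[a, b]%classic y -> `|x - y| < d -> `|f x - f y| < e) _ _.
case.
  move=> x xab; have /cvgrPdist_lt/(_ (e / 2)) := cf x xab.
  rewrite divr_gt0// => /(_ isT); rewrite near_withinE.
  move=> /nbhs_ballP[d /= d0 xd].
  near=> x' r => /= x'ab y yab x'y.
  have r0 : r < d / 2.
    by near: r; apply: nbhs_right_lt; rewrite divr_gt0.
  have x'x : `|x - x'| < d / 2.
    by near: x'; apply: (@cvgr_dist_lt _ _ _ (nbhs x) _ id x) => //; rewrite divr_gt0.
  have h1 : `|f x - f x'| < e / 2.
    by apply: xd => //; apply: lt_trans x'x _; lra.
  have h2 : `|f x - f y| < e / 2.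
    apply: xd => //; rewrite /ball/=.
    by have := ler_distD x' x y; lra.
  by have := ler_distD (f x) (f x') (f y); rewrite distrC in h1; lra.
move=> d /= d0 H; exists (d / 2); first by rewrite divr_gt0.
move=> x y xab yab xy; apply: (H (d / 2)) => //=; last by rewrite divr_gt0.
by rewrite /ball_ sub0r normrN gtr0_norm ?divr_gt0//; lra.
Unshelve. all: by end_near.
Qed.

Lemma within_segment_integrable f a b : {within `[a, b], continuous f} ->
  mu.-integrable `[a, b] (EFin \o f).
Proof. by move=> cf; apply: continuous_compact_integrable => //; exact: segment_compact. Qed.

Lemma Rintegral_itvoc f a b c : {within `[a, b], continuous f} ->
  a <= c -> c <= b ->
  \int[mu]_(x in `[a, b]) f x =
  \int[mu]_(x in `[a, c]) f x + \int[mu]_(x in `]c, b]) f x.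
Proof.
move=> cf ac cb; rewrite -(@Rintegral_itvB _ f (BLeft a) (BRight b) c).
- by rewrite addrC subrK.
- exact: within_segment_integrable.
- by rewrite bnd_simp.
- by rewrite bnd_simp.
Qed.

Lemma Rintegral_near_cst f a b (v e : R) : a <= b ->
  mu.-integrable `]a, b] (EFin \o f) ->
  (forall x, `]a, b]%classic x -> `|f x - v| <= e) ->
  `|\int[mu]_(x in `]a, b]) f x - (b - a) * v| <= (b - a) * e.
Proof.
move=> ab intf fv.
have C r : \int[mu]_(x in `]a, b]) r = (b - a) * r.
  rewrite Rintegral_cst//= lebesgue_measure_itv/= lte_fin.
  case: ltP => [_|ba]; first by rewrite mulrC.
  by have -> : a = b; [apply/eqP; rewrite eq_le ab ba | rewrite subrr mulr0 mul0r].
have Ci r : mu.-integrable `]a, b] (EFin \o cst r).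
  apply: integrableS (within_segment_integrable (a := a) (b := b) _) => //.
    by apply: subset_itvr; rewrite bnd_simp.
  by move=> ?; exact: cvg_cst.
rewrite ler_norml -mulrN lerBrDr -mulrDr lerBlDr -mulrDr -!C.
apply/andP; split; apply: le_Rintegral => //; try exact: Ci.
  by move=> x /fv; rewrite ler_norml => /andP[? ?]; lra.
by move=> x /fv; rewrite ler_norml => /andP[? ?]; lra.
Qed.

Definition riemann_mean f a b n : R :=
  (\sum_(i < n.+1) f (a + (b - a) / n.+1%:R * i%:R)) / n.+1%:R.

Definition mean f a b : R := (\int[mu]_(x in `[a, b]) f x) / (b - a).

Definition moment f a b k : R := mean (fun x => f x ^+ k) a b.

Lemma subdivision_in a b n i : a <= b -> (i <= n.+1)%N ->
  `[a, b]%classic (a + (b - a) / n.+1%:R * i%:R).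
Proof.
move=> ab iN; rewrite /= in_itv/= lerDl mulr_ge0 ?divr_ge0 ?subr_ge0//=.
rewrite -lerBrDl -mulrA ler_piMr ?subr_ge0// mulrC ler_pdivrMr// mul1r.
by rewrite ler_nat.
Qed.

Lemma riemann_sum_near f a b n (e : R) : a < b -> {within `[a, b], continuous f} ->
  (forall x y, `[a, b]%classic x -> `[a, b]%classic y -> `|x - y| <= (b - a) / n.+1%:R ->
    `|f x - f y| <= e) ->
  `|riemann_mean f a b n - mean f a b| <= e.
Proof.
move=> ab cf fe; set h := (b - a) / n.+1%:R.
have h0 : 0 < h by rewrite divr_gt0// subr_gt0.
have P i : (i <= n.+1)%N -> `[a, b]%classic (a + h * i%:R) by apply: subdivision_in; exact: ltW.
have hn : a + h * n.+1%:R = b by rewrite /h divfK// addrC subrK.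
have ih i : a + h * i%:R <= a + h * i.+1%:R.
  by rewrite lerD2l; apply: ler_wpM2l; [exact: ltW|rewrite ler_nat].
suff H k : (k <= n.+1)%N ->
  `|\int[mu]_(x in `[a, a + h * k%:R]) f x - h * \sum_(i < k) f (a + h * i%:R)| <= h * k%:R * e.
  have := H n.+1 (leqnn _); rewrite hn => {}H.
  have w0 : 0 < b - a by rewrite subr_gt0.
  rewrite -(ler_pM2l w0) -[X in X * _ <= _]gtr0_norm// -normrM mulrBr distrC.
  have -> : (b - a) * mean f a b = \int[mu]_(x in `[a, b]) f x.
    by rewrite /mean mulrC divfK// gt_eqF.
  have -> : (b - a) * riemann_mean f a b n = h * \sum_(i < n.+1) f (a + h * i%:R).
    by rewrite /riemann_mean /h mulrA mulrAC.
  by apply: le_trans H _; rewrite /h divfK.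
elim: k => [_|k IH kn].
  rewrite big_ord0 !mulr0 addr0 subr0 mul0r set_itv1 Rintegral_set1 normr0//.
have {IH} := IH (ltnW kn).
have cfk : {within `[a, a + h * k.+1%:R], continuous f}.
  apply: continuous_subspaceW cf; apply: subset_itvl; rewrite bnd_simp.
  by have := P _ kn; rewrite /= in_itv/= => /andP[].
have ak : a <= a + h * k%:R by rewrite lerDl mulr_ge0// ltW.
rewrite (Rintegral_itvoc cfk ak (ih k)) big_ord_recr /= mulrDr.
have inth : mu.-integrable `]a + h * k%:R, a + h * k.+1%:R] (EFin \o f).
  apply: integrableS (within_segment_integrable cfk) => //.
  by apply: subset_itvr; rewrite bnd_simp.
have nearh x : `]a + h * k%:R, a + h * k.+1%:R]%classic x -> `|f x - f (a + h * k%:R)| <= e.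
  rewrite /= in_itv/= => /andP[kx xk]; apply: fe.
  - rewrite /= in_itv/= (le_trans ak (ltW kx))//=; apply: le_trans xk _.
    by have := P _ kn; rewrite /= in_itv/= => /andP[].
  - exact: P (ltnW kn).
  - by rewrite gtr0_norm ?subr_gt0//; rewrite -/h; move: xk; rewrite -(natr1 k); lra.
have := Rintegral_near_cst (ih k) inth nearh.
have -> : a + h * k.+1%:R - (a + h * k%:R) = h by rewrite -natr1; ring.
move: (\int[mu]_(x in `]_, _]) _) (\int[mu]_(x in `[_, _]) _) => I J.
move: (\sum_(i < k) _) => S h1 h2.
have -> : J + I - (h * S + h * f (a + h * k%:R)) = (J - h * S) + (I - h * f (a + h * k%:R)) by ring.
apply: le_trans (ler_normD _ _) _.
have -> : h * k.+1%:R * e = h * k%:R * e + h * e by rewrite -natr1; ring.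
exact: lerD.
Qed.

Lemma cvg_riemann_mean f a b : a < b -> {within `[a, b], continuous f} ->
  riemann_mean f a b n @[n --> \oo] --> mean f a b.
Proof.
move=> ab cf; apply/cvgrPdist_le => e e0.
have [d d0 fd] := within_segment_unif cf e0.
have w0 : 0 < b - a by rewrite subr_gt0.
near=> n; rewrite distrC; apply: riemann_sum_near => // x y xab yab xy.
apply/ltW/fd => //; apply: le_lt_trans xy _.
rewrite ltr_pdivrMr// mulrC -ltr_pdivrMr//.
apply: lt_le_trans (truncnS_gt _) _.
by rewrite ler_nat ltnS; near: n; exact: nbhs_infty_ge.
Unshelve. all: by end_near.
Qed.

Lemma within_segment_bounded f a b : {within `[a, b], continuous f} ->
  exists2 M, 0 <= M & forall x, `[a, b]%classic x -> `|f x| <= M.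
Proof.
move=> cf; have /compact_bounded[M [_ mrt]] := continuous_compact cf (@segment_compact R a b).
exists (`|M| + 1); first by rewrite addr_ge0.
move=> x xab; apply: (mrt (`|M| + 1)); last by exists x.
by apply: le_lt_trans (ler_norm _) _; rewrite ltrDl.
Qed.

Definition concave_on a b f := forall x y (t : R), `[a, b]%classic x -> `[a, b]%classic y ->
  0 <= t <= 1 -> t * f x + (1 - t) * f y <= f (t * x + (1 - t) * y).

(** The values of f at equidistant points, less their mean, form a concave
    sequence of sum 0, and the left-hand side is the mean of its cubes. *)
Lemma riemann_mean_third_moment f a b n M : a <= b -> concave_on a b f ->
  (forall x, `[a, b]%classic x -> `|f x| <= M) ->
  let m k := riemann_mean (fun x => f x ^+ k) a b n in
  (m 3 - 3 * m 1%N * m 2 + 2 * m 1%N ^+ 3 <= (2 * M) ^+ 3 / n.+1%:R : Prop).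
Proof.
move=> ab cf fM m.
pose x i := a + (b - a) / n.+1%:R * i%:R.
pose s i := f (x i) - m 1%N.
have P i : (i <= n.+1)%N -> `[a, b]%classic (x i) by exact: subdivision_in.
have n0 : n.+1%:R != 0 :> R by [].
have mE k : \sum_(i < n.+1) f (x i) ^+ k = n.+1%:R * m k.
  by rewrite /m /riemann_mean mulrC divfK.
have mE1 : \sum_(i < n.+1) f (x i) = n.+1%:R * m 1%N.
  by rewrite -mE; apply: eq_bigr => i _; rewrite expr1.
have m1M : `|m 1%N| <= M.
  have nn : 0 < n.+1%:R :> R by [].
  rewrite -(ler_pM2l nn) -[X in X * `|_|](@ger0_norm _ n.+1%:R)// -normrM -mE1.
  apply: le_trans (ler_norm_sum _ _ _) _.
  rewrite mulr_natl -[X in _ *+ X]card_ord -sumr_const; apply: ler_sum => i _.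
  by apply/fM/P; exact/ltnW.
have s0 : \sum_(i < n.+1) s i = 0.
  by rewrite /s sumrB mE1 sumr_const card_ord mulr_natl subrr.
have scon : concave_seq s n.
  move=> i iN; rewrite /s.
  have h2 : 0 <= (2^-1 : R) <= 1 by apply/andP; split; lra.
  have := cf (x i) (x i.+2) 2^-1 (P _ (ltnW (ltnW (leqW iN)))) (P _ (leqW iN)) h2.
  have -> : 2^-1 * x i + (1 - 2^-1) * x i.+2 = x i.+1.
    by rewrite /x -[i.+2]addn2 -[i.+1]addn1 !natrD; field.
  lra.
have sM i : (i <= n)%N -> `|s i| <= 2 * M.
  move=> iN; rewrite /s; apply: le_trans (ler_normB _ _) _.
  by have := fM _ (P i (leqW iN)); lra.
have := concave_seq_sum_cube_le sM scon s0.
have -> : \sum_(i < n.+1) s i ^+ 3 = n.+1%:R * (m 3 - 3 * m 1%N * m 2 + 2 * m 1%N ^+ 3).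
  transitivity (\sum_(i < n.+1) f (x i) ^+ 3
      - 3 * m 1%N * \sum_(i < n.+1) f (x i) ^+ 2
      + (3 * m 1%N ^+ 2) * \sum_(i < n.+1) f (x i)
      - \sum_(i < n.+1) m 1%N ^+ 3).
    rewrite !mulr_sumr -sumrB -big_split/= -sumrB.
    by apply: eq_bigr => i _; rewrite /s; ring.
  by rewrite !mE mE1 sumr_const card_ord -[_ *+ _]mulr_natl; ring.
by rewrite ler_pdivlMr// mulrC.
Qed.

(** The difference of the two sides is the third central moment of f: the claim is
    that a concave function is negatively skewed. *)
Lemma concave_third_moment f a b : a < b -> {within `[a, b], continuous f} ->
  concave_on a b f ->
  moment f a b 3 <=
    3 * moment f a b 1 * moment f a b 2 - 2 * moment f a b 1 ^+ 3.
Proof.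
move=> ab cf conf; pose m := moment f a b; rewrite -/(m 1%N) -/(m 2) -/(m 3).
have cX k : {within `[a, b], continuous (fun x => f x ^+ k)}.
  by move=> x; exact: (cvg_comp _ _ (cf x) (@exprn_continuous R k (f x))).
have [M M0 fM] := within_segment_bounded cf.
pose r n k := riemann_mean (fun x => f x ^+ k) a b n.
have rm k : r n k @[n --> \oo] --> m k by exact: cvg_riemann_mean.
suff : 0 <= (2 * M) ^+ 3 * 0 - (m 3 - 3 * m 1%N * m 2 + 2 * m 1%N ^+ 3) by lra.
apply: (@cvgr_to_ge _ \oo _ _ (fun n => (2 * M) ^+ 3 * n.+1%:R^-1 -
    (r n 3 - 3 * r n 1%N * r n 2 + 2 * r n 1%N ^+ 3))).
  apply: cvgB; first by apply: cvgM; [exact: cvg_cst|exact: cvg_harmonic].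
  apply: cvgD; first apply: cvgB => //.
    by apply: cvgM => //; apply: cvgM => //; exact: cvg_cst.
  apply: cvgM; first exact: cvg_cst.
  exact: (cvg_comp _ _ (rm 1%N) (@exprn_continuous R 3 (m 1%N))).
by near=> n; rewrite subr_ge0; apply: riemann_mean_third_moment => //; exact: ltW.
Unshelve. all: by end_near.
Qed.
End segment_integrals.

(** * Planar bodies, reflections and shears *)

Section plane_bodies.
Context {R : realType}.
Implicit Types (K : set (R * R)) (p q : R * R) (s t x y e tau : R).

Definition segment_pt t p q : R * R :=
  (t * p.1 + (1 - t) * q.1, t * p.2 + (1 - t) * q.2).

(** Convex bodies, with convexity spelled out on coordinates and plain real
    coefficients. *)
Definition body K := [/\ compact K,
  forall p q t, K p -> K q -> 0 <= t <= 1 -> K (segment_pt t p q)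
  & interior K !=set0].

Lemma convex_body_body K : convex_body K -> body K.
Proof.
move=> [cK convK iK]; split=> // p q t Kp Kq /andP[t0 t1].
have t01 : Itv.spec (@Itv.num_sem R) (Itv.Real `[0%Z, 1%Z]) t.
  by apply/and3P; split; rewrite ?in_itv/= ?num_real ?t0 ?t1.
have := convK p q (Itv.mk t01).
by rewrite !inE => /(_ Kp Kq).
Qed.

Lemma interiorP K p : interior K p <->
  exists2 e : R, 0 < e & forall q, `|p.1 - q.1| < e -> `|p.2 - q.2| < e -> K q.
Proof.
split=> [/nbhs_ballP[e /= e0 H]|[e e0 H]].
  by exists e => // q h1 h2; apply: H; split.
by apply/nbhs_ballP; exists e => //= q [h1 h2]; exact: H.
Qed.

Lemma body_closed K : body K -> closed K.
Proof.
by move=> [cK _ _]; apply: compact_closed => //; exact: norm_hausdorff.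
Qed.

Lemma body_nonempty K : body K -> K !=set0.
Proof. by move=> [_ _ [p /interior_subset]]; exists p. Qed.

Lemma boundary_sub K : body K -> boundary K `<=` K.
Proof. by move=> /body_closed/closure_id Kc p []; rewrite -Kc. Qed.

(** The homothety of ratio t centred at q maps a neighbourhood of p into K. *)
Lemma interior_segment K p q t : body K -> interior K p -> K q -> 0 < t <= 1 ->
  interior K (segment_pt t p q).
Proof.
move=> [_ cK _] /interiorP[e e0 pe] Kq /andP[t0 t1].
apply/interiorP; exists (t * e); first exact: mulr_gt0.
move=> r /= h1 h2.
pose z := (p.1 + (r.1 - (t * p.1 + (1 - t) * q.1)) / t,
           p.2 + (r.2 - (t * p.2 + (1 - t) * q.2)) / t).
have Kz : K z.
  by apply: pe; rewrite /z/= opprD addrA subrr sub0r normrN normrM normfV (gtr0_norm t0)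
    ltr_pdivrMr// distrC [e * t]mulrC.
have -> : r = segment_pt t z q.
  rewrite /segment_pt /z /= [LHS]surjective_pairing; congr pair; field; exact: lt0r_neq0.
by apply: cK => //; rewrite (ltW t0).
Qed.

Lemma continuous_pair (T : topologicalType) (f g : T -> R) :
  continuous f -> continuous g -> continuous (fun z => (f z, g z)).
Proof.
move=> cf cg z.
exact: (@cvg_pair _ _ _ (nbhs z) (nbhs (f z)) (nbhs (g z)) _ _ _ f g (cf z) (cg z)).
Qed.

Lemma continuous_fst2 : continuous (fst : R * R -> R).
Proof. by move=> q; exact: cvg_fst. Qed.

Lemma continuous_snd2 : continuous (snd : R * R -> R).
Proof. by move=> q; exact: cvg_snd. Qed.

(** The reflection exchanges the upper and the lower ends of the vertical chords,
    which carries every fact about [top] over to [bot]. *)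
Definition flip K : set (R * R) := [set p | K (p.1, - p.2)].

Lemma flip_body K : body K -> body (flip K).
Proof.
move=> [cK vK [p ip]]; split.
- have -> : flip K = (fun p => (p.1, - p.2)) @` K.
    apply/seteqP; split=> [q Kq|_ [q Kq <-]].
      by exists (q.1, - q.2) => //=; rewrite opprK -surjective_pairing.
    by rewrite /flip/= opprK -surjective_pairing.
  apply: continuous_compact => //; apply: continuous_subspaceT.
  apply: continuous_pair => q; first exact: continuous_fst2.
  by apply: continuousN; exact: continuous_snd2.
- move=> q r t Kq Kr t01; have := vK _ _ _ Kq Kr t01.
  by rewrite /flip /segment_pt /= !mulrN opprD.
- exists (p.1, - p.2); move/interiorP: ip => [e e0 H]; apply/interiorP; exists e => //.
  by move=> q /= h1 h2; apply: H => //=; rewrite opprK -normrN opprD.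
Qed.

(** The vertical chord of [shear tau K] over s corresponds to the chord of K on the
    line x - tau * y = s, so that vertical chords suffice for all directions but the
    horizontal one. *)
Definition shear tau K : set (R * R) := [set p | K (p.1 + tau * p.2, p.2)].

Lemma shearK tau K : shear (- tau) (shear tau K) = K.
Proof.
apply/seteqP; split => q; rewrite /shear/= mulNr ?addrNK ?subrK -?surjective_pairing//.
Qed.

Lemma interior_shear tau K p : interior (shear tau K) p <->
  interior K (p.1 + tau * p.2, p.2).
Proof.
have A t L q : interior L (q.1 + t * q.2, q.2) -> interior (shear t L) q.
  move=> /interiorP[e e0 H]; apply/interiorP; exists (e / (1 + `|t|)).
    by rewrite divr_gt0// ltr_wpDr.
  have t1 : 0 < 1 + `|t| by rewrite ltr_wpDr.
  move=> r; rewrite !ltr_pdivlMr// => h1 h2; apply: H => /=.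
    have -> : q.1 + t * q.2 - (r.1 + t * r.2) = (q.1 - r.1) + t * (q.2 - r.2) by ring.
    apply: le_lt_trans (ler_normD _ _) _; rewrite normrM.
    have [h|h] := leP `|q.1 - r.1| `|q.2 - r.2|; first lra.
    by have := ler_wpM2l (normr_ge0 t) (ltW h); lra.
  by apply: le_lt_trans h2; rewrite ler_peMr// lerDl.
split=> [H|]; last exact: A.
rewrite -(shearK tau K); apply: (A (- tau)) => /=.
by rewrite mulNr addrK -surjective_pairing.
Qed.

Lemma shear_body tau K : body K -> body (shear tau K).
Proof.
move=> [cK vK [p ip]]; split.
- have -> : shear tau K = (fun p => (p.1 - tau * p.2, p.2)) @` K.
    apply/seteqP; split=> [q Kq|_ [q Kq <-]].
      by exists (q.1 + tau * q.2, q.2) => //=; rewrite addrK -surjective_pairing.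
    by rewrite /shear/= subrK -surjective_pairing.
  apply: continuous_compact => //; apply: continuous_subspaceT.
  apply: continuous_pair => q; last exact: continuous_snd2.
  apply: continuousB; first exact: continuous_fst2.
  by apply: continuousM; [exact: cst_continuous|exact: continuous_snd2].
- move=> q r t Kq Kr t01; have := vK _ _ _ Kq Kr t01.
  by rewrite /shear /segment_pt /=; congr (K (_, _)); ring.
- by exists (p.1 - tau * p.2, p.2); apply/interior_shear; rewrite /= subrK -surjective_pairing.
Qed.

Definition lo K : R := inf (fst @` K).
Definition hi K : R := sup (fst @` K).
Definition top K s : R := sup [set y | K (s, y)].
Definition bot K s : R := - top (flip K) s.

Lemma continuous_fst_within K : {within K, continuous (fst : R * R -> R)}.
Proof. by apply: continuous_subspaceT => q; exact: cvg_fst. Qed.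

Lemma continuous_snd_within K : {within K, continuous (snd : R * R -> R)}.
Proof. by apply: continuous_subspaceT => q; exact: cvg_snd. Qed.

Lemma hi_max K : body K -> (exists y, K (hi K, y)) /\ (forall p, K p -> p.1 <= hi K).
Proof.
move=> bK; have K0 := body_nonempty bK; have [cK _ _] := bK.
have [c cK' cmax] := compact_EVT_max K0 cK (@continuous_fst_within K).
have ub p : K p -> p.1 <= c.1 by move=> Kp; apply: cmax; rewrite inE.
have Kc : K c by rewrite inE in cK'.
have hc : hi K = c.1.
  apply/eqP; rewrite eq_le; apply/andP; split.
    by apply: sup_le_ub; [exact: image_nonempty|move=> _ [p Kp <-]; exact: ub].
  apply: ub_le_sup; last by exists c.
  by exists c.1 => _ [p Kp <-]; exact: ub.
by rewrite hc; split => //; exists c.2; rewrite -surjective_pairing.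
Qed.

Lemma lo_min K : body K -> (exists y, K (lo K, y)) /\ (forall p, K p -> lo K <= p.1).
Proof.
move=> bK; have K0 := body_nonempty bK; have [cK _ _] := bK.
have [c cK' cmin] := compact_EVT_min K0 cK (@continuous_fst_within K).
have ub p : K p -> c.1 <= p.1 by move=> Kp; apply: cmin; rewrite inE.
have Kc : K c by rewrite inE in cK'.
have hc : lo K = c.1.
  apply/eqP; rewrite eq_le; apply/andP; split.
    apply: ge_inf; last by exists c.
    by exists c.1 => _ [p Kp <-]; exact: ub.
  by apply: lb_le_inf; [exact: image_nonempty|move=> _ [p Kp <-]; exact: ub].
by rewrite hc; split => //; exists c.2; rewrite -surjective_pairing.
Qed.

Lemma lo_lt_hi K : body K -> lo K < hi K.
Proof.
move=> bK; have [_ h1] := lo_min bK; have [_ h2] := hi_max bK.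
have [_ _ [p /interiorP[e e0 H]]] := bK.
have [h3 h4] : K (p.1 - e / 2, p.2) /\ K (p.1 + e / 2, p.2).
  split; apply: H => /=; rewrite ?subrr ?normr0//.
    by rewrite opprB addrCA subrr addr0 gtr0_norm; lra.
  by rewrite opprD addrA subrr sub0r normrN gtr0_norm; lra.
by have := h1 _ h3; have := h2 _ h4 => /=; lra.
Qed.

Lemma chord_nonempty K s : body K -> lo K <= s <= hi K -> exists y, K (s, y).
Proof.
move=> bK /andP[ls sh]; have [[y1 h1] _] := lo_min bK; have [[y2 h2] _] := hi_max bK.
have lh := lo_lt_hi bK; have [_ vK _] := bK.
have w0 : 0 < hi K - lo K by rewrite subr_gt0.
pose t := (hi K - s) / (hi K - lo K).
have t01 : 0 <= t <= 1.
  by rewrite divr_ge0 ?subr_ge0 ?(ltW lh)//= ler_pdivrMr// mul1r lerD2l lerN2.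
exists (t * y1 + (1 - t) * y2); have := vK _ _ _ h1 h2 t01; rewrite /segment_pt /=.
by have -> : t * lo K + (1 - t) * hi K = s by rewrite /t; field; exact: lt0r_neq0.
Qed.

Lemma top_max K s : body K -> lo K <= s <= hi K ->
  K (s, top K s) /\ (forall y, K (s, y) -> y <= top K s).
Proof.
move=> bK sK; have [y0 Ky0] := chord_nonempty bK sK; have [cK _ _] := bK.
pose A := K `&` [set p | p.1 = s].
have cA : compact A.
  apply: compact_closedI => //.
  exact: (@preimage_closed _ _ fst [set x | x = s] (in1W continuous_fst2) (closed_eq (y := s))).
have [|c] := compact_EVT_max _ cA (@continuous_snd_within A).
  by exists (s, y0).
rewrite inE => -[Kc c1] cmax; rewrite /= in c1.
have ub y : K (s, y) -> y <= c.2 by move=> Kp; apply: (cmax (s, y)); rewrite inE.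
have Kc' : K (s, c.2) by rewrite -c1 -surjective_pairing.
have -> : top K s = c.2.
  apply/eqP; rewrite eq_le; apply/andP; split.
    by apply: sup_le_ub; [exists y0|move=> y /=; exact: ub].
  by apply: ub_le_sup => //; exists c.2 => y /=; exact: ub.
by [].
Qed.
End plane_bodies.

(** * Ends of the vertical chords *)

Section chords.
Context {R : realType}.
Implicit Types (K : set (R * R)) (p q : R * R) (s t x y e tau : R).

Lemma fst_flip K : fst @` flip K = fst @` K.
Proof.
apply/seteqP; split=> [_ [p Kp <-]|_ [p Kp <-]]; first by exists (p.1, - p.2).
by exists (p.1, - p.2) => //; rewrite /flip/= opprK -surjective_pairing.
Qed.

Lemma lo_flip K : lo (flip K) = lo K. Proof. by rewrite /lo fst_flip. Qed.
Lemma hi_flip K : hi (flip K) = hi K. Proof. by rewrite /hi fst_flip. Qed.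

Lemma body_lo_hi K p : body K -> K p -> lo K <= p.1 <= hi K.
Proof.
by move=> bK Kp; rewrite (proj2 (lo_min bK))//= (proj2 (hi_max bK)).
Qed.

Lemma bot_min K s : body K -> lo K <= s <= hi K ->
  K (s, bot K s) /\ (forall y, K (s, y) -> bot K s <= y).
Proof.
move=> bK sK.
have [h1 h2] : flip K (s, top (flip K) s) /\ (forall y, flip K (s, y) -> y <= top (flip K) s).
  by apply: top_max; [exact: flip_body|rewrite lo_flip hi_flip].
split; first exact: h1.
by move=> y Ky; rewrite /bot lerNl; apply: h2; rewrite /flip/= opprK.
Qed.

Lemma chordP K s y : body K -> lo K <= s <= hi K ->
  K (s, y) <-> bot K s <= y <= top K s.
Proof.
move=> bK sK; have [h1 h2] := bot_min bK sK; have [h3 h4] := top_max bK sK.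
split=> [Ky|/andP[h5 h6]]; first by rewrite h2// h4.
have [_ vK _] := bK.
have [E|E] := eqVneq (bot K s) (top K s).
  by have -> : y = bot K s; [apply/eqP; rewrite eq_le h5 E h6|].
have w0 : 0 < top K s - bot K s.
  by rewrite subr_gt0 lt_neqAle E (le_trans h5 h6).
pose t := (top K s - y) / (top K s - bot K s).
have t01 : 0 <= t <= 1.
  by rewrite divr_ge0 ?subr_ge0// ?(le_trans h5 h6)//= ler_pdivrMr// mul1r lerD2l lerN2.
have := vK _ _ t h1 h3 t01; rewrite /segment_pt /=.
have -> : t * s + (1 - t) * s = s by ring.
by have -> // : t * bot K s + (1 - t) * top K s = y by rewrite /t; field; exact: lt0r_neq0.
Qed.

Lemma bot_le_top K s : body K -> lo K <= s <= hi K -> bot K s <= top K s.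
Proof.
move=> bK sK; have [h1 h2] := bot_min bK sK; have [h3 h4] := top_max bK sK.
exact: h2.
Qed.

Lemma top_concave K : body K -> concave_on (lo K) (hi K) (top K).
Proof.
move=> bK x y t; rewrite /= !in_itv/= => xK yK t01.
have [h1 _] := top_max bK xK; have [h2 _] := top_max bK yK.
have [_ vK _] := bK; have h3 := vK _ _ _ h1 h2 t01.
have h4 := body_lo_hi bK h3.
by have [_] := top_max bK h4; apply; exact: h3.
Qed.

Lemma bot_convex K : body K -> concave_on (lo K) (hi K) (fun s => - bot K s).
Proof.
move=> bK; have := top_concave (flip_body bK); rewrite lo_flip hi_flip.
by move=> H x y t xK yK t01; rewrite /bot !opprK; exact: H.
Qed.

(** Compactness: the abscissas of the points of K of height at least top K s + e
    form a closed set, and s is not among them. *)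
Lemma top_usc K s e : body K -> 0 < e -> lo K <= s <= hi K ->
  exists2 d : R, 0 < d & forall x, lo K <= x <= hi K -> `|s - x| < d -> top K x < top K s + e.
Proof.
move=> bK e0 sK; have [cK _ _] := bK.
pose A := fst @` (K `&` [set p | top K s + e <= p.2]).
have cA : compact A.
  apply: continuous_compact; first by apply: continuous_subspaceT; exact: continuous_fst2.
  apply: compact_closedI => //.
  exact: (@preimage_closed _ _ snd [set x | top K s + e <= x] (in1W continuous_snd2) (closed_ge (y := _))).
have oA : open (~` A).
  by rewrite openC; apply: compact_closed => //; exact: norm_hausdorff.
have As : (~` A) s.
  move=> [[x y] [Kp /= h1] /= E]; rewrite E in Kp.
  by have [_ /(_ _ Kp)] := top_max bK sK; lra.
have /nbhs_ballP[d /= d0 H] := open_nbhs_nbhs (conj oA As).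
exists d => // x xK sx; rewrite ltNge; apply/negP => h.
by apply: (H x sx); exists (x, top K x) => //; split => //=; exact: (proj1 (top_max bK xK)).
Qed.

(** Concavity alone gives lower semicontinuity, also at the ends of the interval,
    where s can only be approached from one side. *)
Lemma concave_lsc (a b s e : R) (f : R -> R) : a < b -> concave_on a b f ->
  0 < e -> `[a, b]%classic s ->
  exists2 d : R, 0 < d & forall x, `[a, b]%classic x -> `|s - x| < d -> f s - e < f x.
Proof.
move=> ab cf e0 sab.
(* towards an end point c the graph lies above the chord from s to c *)
have A c : `[a, b]%classic c ->
  exists2 d : R, 0 < d & forall x, `[a, b]%classic x -> `|s - x| < d ->
    0 <= (x - s) * (c - x) -> f s - e < f x.
  move=> cab; have [sc|sc] := eqVneq s c.
    exists 1 => // x _ _; rewrite -sc => h.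
    have -> : x = s; last by lra.
    have := sqr_ge0 (x - s) => h2; have : (x - s) ^+ 2 = 0 by lra.
    by move/eqP; rewrite sqrf_eq0 subr_eq0 => /eqP.
  have w0 : 0 < `|c - s| by rewrite normr_gt0 subr_eq0 eq_sym.
  pose M := `|f s - f c| + 1.
  have M0 : 0 < M by rewrite ltr_wpDl.
  exists (e * `|c - s| / M); first by rewrite divr_gt0 ?mulr_gt0.
  move=> x xab; rewrite ltr_pdivlMr// => sx h.
  pose t := `|x - s| / `|c - s|.
  have t0 : 0 <= t by rewrite divr_ge0.
  have tE : x - s = t * (c - s).
    rewrite /t; have [cs|cs] := ltP 0 (c - s).
      have xs : 0 <= x - s by rewrite leNgt; apply/negP => h'; nra.
      by rewrite (gtr0_norm cs) ger0_norm// divfK// lt0r_neq0.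
    have cs' : c - s < 0 by rewrite lt_neqAle cs subr_eq0 eq_sym sc.
    have xs : x - s <= 0 by rewrite leNgt; apply/negP => h'; nra.
    by rewrite (ltr0_norm cs') ler0_norm// invrN mulrNN divfK// lt_eqF.
  have t1 : t <= 1.
    rewrite leNgt; apply/negP => t1.
    have : (x - s) * (c - x) < 0.
      have -> : (x - s) * (c - x) = t * (1 - t) * `|c - s| ^+ 2.
        rewrite real_normK ?num_real// tE.
        have -> : c - x = (1 - t) * (c - s) by rewrite mulrBl mul1r -tE; ring.
        ring.
      rewrite nmulr_rlt0 ?exprn_gt0//; nra.
    by lra.
  have := cf _ _ _ cab sab (introT andP (conj t0 t1)).
  have -> : t * c + (1 - t) * s = x by rewrite -[RHS](subrK s) tE; ring.
  apply: lt_le_trans.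
  have h3 : t * M < e.
    by rewrite /t mulrAC ltr_pdivrMr// -[`|x - s|]normrN opprB.
  have h4 : t * (f s - f c) <= t * M.
    by apply: ler_wpM2l => //; rewrite (le_trans (ler_norm _))// lerDl.
  lra.
have [d1 d10 h1] := A a (introT andP (conj (lexx a) (ltW ab))).
have [d2 d20 h2] := A b (introT andP (conj (ltW ab) (lexx b))).
exists (Num.min d1 d2); first by rewrite lt_min d10.
move=> x xab; rewrite lt_min => /andP[x1 x2].
move: (xab); rewrite /= in_itv/= => /andP[ax xb].
have [xs|/ltW sx] := leP x s; first by apply: h1 => //; nra.
by apply: h2 => //; nra.
Qed.

Lemma top_continuous K : body K -> {within `[lo K, hi K], continuous (top K)}.
Proof.
move=> bK; apply/subspace_continuousP => s sK.
apply/cvgrPdist_lt => e e0; rewrite near_withinE.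
have [d1 d10 h1] := top_usc bK e0 sK.
have [d2 d20 h2] := concave_lsc (lo_lt_hi bK) (top_concave bK) e0 sK.
apply/nbhs_ballP; exists (Num.min d1 d2) => /=; first by rewrite lt_min d10.
move=> x; rewrite /ball/= lt_min => /andP[x1 x2] xK.
have := h1 _ xK x1; have := h2 _ xK x2 => h3 h4.
have h5 : `|top K s - top K x| < e by rewrite ltr_norml; apply/andP; split; lra.
exact: h5.
Qed.

Lemma bot_continuous K : body K -> {within `[lo K, hi K], continuous (bot K)}.
Proof.
move=> bK; have := top_continuous (flip_body bK); rewrite lo_flip hi_flip => H x.
by apply: continuousN; exact: H.
Qed.

(** The chord crosses a segment from an interior point of K to a point of K on one
    of the two vertical supporting lines; that segment is interior except for its
    last point. *)
Lemma chord_meets_interior K s : body K -> lo K < s < hi K ->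
  exists y, interior K (s, y).
Proof.
move=> bK /andP[ls sh]; have [_ _ [p ip]] := bK.
have [y1 K1] := (proj1 (lo_min bK)); have [y2 K2] := (proj1 (hi_max bK)).
have Kp := interior_subset ip; have /andP[lp ph] := body_lo_hi bK Kp.
have A q : K q -> (exists2 t, 0 < t <= 1 & t * p.1 + (1 - t) * q.1 = s) ->
    exists y, interior K (s, y).
  move=> Kq [t t01 <-]; exists (t * p.2 + (1 - t) * q.2).
  exact: (interior_segment bK ip Kq t01).
have [ps|sp] := leP p.1 s.
  apply: (A _ K2); exists ((hi K - s) / (hi K - p.1)) => /=.
    have w0 : 0 < hi K - p.1 by lra.
    apply/andP; split; first by apply: divr_gt0 => //; lra.
    by rewrite ler_pdivrMr//; lra.
  by field; rewrite gt_eqF//; lra.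
apply: (A _ K1); exists ((s - lo K) / (p.1 - lo K)) => /=.
  have w0 : 0 < p.1 - lo K by lra.
  apply/andP; split; first by apply: divr_gt0 => //; lra.
    by rewrite ler_pdivrMr//; lra.
by field; rewrite gt_eqF//; lra.
Qed.

Lemma chord_interior K s y : body K -> lo K < s < hi K -> bot K s < y < top K s ->
  interior K (s, y).
Proof.
move=> bK sK /andP[by_ yt]; have [m im] := chord_meets_interior bK sK.
have sK' : lo K <= s <= hi K by case/andP: sK => /ltW-> /ltW->.
have [Kb _] := bot_min bK sK'; have [Kt _] := top_max bK sK'.
have A z : K (s, z) -> (exists2 t, 0 < t <= 1 & t * m + (1 - t) * z = y) ->
    interior K (s, y).
  move=> Kz [t t01 <-]; have := interior_segment bK im Kz t01.
  by rewrite /segment_pt /=; have -> : t * s + (1 - t) * s = s by ring.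
have [my|ym] := leP m y.
  apply: (A _ Kt); exists ((top K s - y) / (top K s - m)).
    have w0 : 0 < top K s - m by lra.
    apply/andP; split; first by apply: divr_gt0 => //; lra.
    by rewrite ler_pdivrMr//; lra.
  by field; rewrite gt_eqF//; lra.
apply: (A _ Kb); exists ((y - bot K s) / (m - bot K s)).
  have w0 : 0 < m - bot K s by lra.
  apply/andP; split; first by apply: divr_gt0 => //; lra.
    by rewrite ler_pdivrMr//; lra.
by field; rewrite gt_eqF//; lra.
Qed.

(** The points strictly between the ends of such a chord are interior. *)
Lemma boundary_chord K p : body K -> boundary K p -> lo K < p.1 < hi K ->
  p.2 = top K p.1 \/ p.2 = bot K p.1.
Proof.
move=> bK bp pK; have Kp := boundary_sub bK bp; case: bp => _ ip.
have pK' := body_lo_hi bK Kp.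
have := Kp; rewrite [p in K p]surjective_pairing => /(chordP _ bK pK')/andP[h1 h2].
have [->|E1] := eqVneq p.2 (top K p.1); first by left.
have [->|E2] := eqVneq p.2 (bot K p.1); first by right.
case: ip; rewrite [p]surjective_pairing; apply: chord_interior => //.
by rewrite !lt_neqAle E1 eq_sym E2 h1 h2.
Qed.

Lemma top_boundary K s : body K -> lo K <= s <= hi K -> boundary K (s, top K s).
Proof.
move=> bK sK; have [h1 h2] := top_max bK sK; split; first exact: subset_closure.
move=> /interiorP[e e0 H].
have := H (s, top K s + e / 2); rewrite /= subrr normr0 opprD addrA subrr sub0r normrN.
by rewrite gtr0_norm ?divr_gt0// => /(_ e0 _)/h2; lra.
Qed.

Lemma bot_boundary K s : body K -> lo K <= s <= hi K -> boundary K (s, bot K s).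
Proof.
move=> bK sK; have [h1 h2] := bot_min bK sK; split; first exact: subset_closure.
move=> /interiorP[e e0 H].
have := H (s, bot K s - e / 2); rewrite /= subrr normr0 opprB addrCA subrr addr0.
by rewrite gtr0_norm ?divr_gt0// => /(_ e0 _)/h2; lra.
Qed.

Lemma boundary_shear tau K p : body K -> boundary (shear tau K) p <->
  boundary K (p.1 + tau * p.2, p.2).
Proof.
move=> bK; have bS := shear_body tau bK; rewrite /boundary.
have <- := (closure_id _).1 (body_closed bK).
have <- := (closure_id _).1 (body_closed bS).
split=> -[h1 h2]; split=> //; first by move/(interior_shear tau K p).
by move/(interior_shear tau K p).
Qed.

End chords.

(** * Area *)

Section plane_measure.
Context {R : realType}.
Local Notation mu := (@lebesgue_measure R).
Implicit Types (K A : set (R * R)) (p q : R * R) (s t x y e tau : R).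

(** An open set is the union of the rational rectangles that it contains. *)
Lemma open_measurable_plane A : open A -> measurable A.
Proof.
move=> oA.
pose B (a b c d : rat) : set (R * R) :=
  if asbool (`]ratr a, ratr b[%classic `*` `]ratr c, ratr d[%classic `<=` A)
  then `]ratr a, ratr b[%classic `*` `]ratr c, ratr d[%classic else set0.
have -> : A = \bigcup_a \bigcup_b \bigcup_c \bigcup_d B a b c d.
  apply/seteqP; split=> [p Ap|p [a _ [b _ [c _ [d _]]]]]; last first.
    by rewrite /B; case: ifPn => [/asboolP|//]; apply.
  have /interiorP[e e0 H] : interior A p by rewrite (interior_id _).1.
  have [a /andP[a1 a2]] := @rat_in_itvoo R (p.1 - e) p.1 ltac:(lra).
  have [b /andP[b1 b2]] := @rat_in_itvoo R p.1 (p.1 + e) ltac:(lra).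
  have [c /andP[c1 c2]] := @rat_in_itvoo R (p.2 - e) p.2 ltac:(lra).
  have [d /andP[d1 d2]] := @rat_in_itvoo R p.2 (p.2 + e) ltac:(lra).
  rewrite !bnd_simp in a1 a2 b1 b2 c1 c2 d1 d2.
  exists a => //; exists b => //; exists c => //; exists d => //.
  rewrite /B ifT; last first.
    apply/asboolP => q [/=]; rewrite !in_itv/= => /andP[q1 q2] /andP[q3 q4].
    by apply: H; rewrite ltr_norml; apply/andP; split; lra.
  by split; rewrite /= in_itv/= ?a2 ?b1 ?c2 ?d1.
apply: bigcupT_measurable_rat => a; apply: bigcupT_measurable_rat => b.
apply: bigcupT_measurable_rat => c; apply: bigcupT_measurable_rat => d.
rewrite /B; case: ifP => // _; apply: measurableX; exact: measurable_itv.
Qed.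

Lemma closed_measurable_plane A : closed A -> measurable A.
Proof.
move=> cA; rewrite -[A]setCK; apply: measurableC; apply: open_measurable_plane.
exact: closed_openC.
Qed.

(** The identity between two presentations of the plane as a measurable space,
    along which integrals for the product measure become integrals for [area]. *)
Let idpl (z : measurableTypeR R * measurableTypeR R) : R * R := z.

Let measurable_idpl : measurable_fun setT idpl.
Proof. by move=> _ A mA; rewrite setTI; exact: mA. Qed.

Let area0 : area (set0 : set (R * R)) = 0%E.
Proof. exact: (measure0 (mu \x mu)%E). Qed.

Let area_ge0 A : (0 <= area A)%E.
Proof. exact: (measure_ge0 (mu \x mu)%E). Qed.

Let area_sigma_additive : semi_sigma_additive (area : set (R * R) -> \bar R).
Proof. exact: (@measure_semi_sigma_additive _ _ _ (mu \x mu)%E). Qed.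

HB.instance Definition _ := isMeasure.Build _ (R * R)%type R area
  area0 area_ge0 area_sigma_additive.

Lemma area_tonelli (f : R * R -> \bar R) : measurable_fun setT f ->
  (forall z, (0 <= f z)%E) ->
  (\int[area]_z f z = \int[mu]_x \int[mu]_y f (x, y))%E.
Proof.
move=> mf f0.
transitivity (\int[mu \x mu]_z (f \o idpl) z)%E; last first.
  exact: (@fubini_tonelli1 _ _ _ _ _ mu mu (f \o idpl)).
have := @ge0_integral_pushforward _ _ _ _ R _ measurable_idpl (mu \x mu)%E setT f measurableT mf.
by rewrite preimage_setT => <- //; exact: eq_measure_integral.
Qed.

Lemma area_tonelli2 (f : R * R -> \bar R) : measurable_fun setT f ->
  (forall z, (0 <= f z)%E) ->
  (\int[area]_z f z = \int[mu]_y \int[mu]_x f (x, y))%E.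
Proof.
move=> mf f0; rewrite area_tonelli//.
exact: (@fubini_tonelli _ _ _ _ _ mu mu (f \o idpl)).
Qed.

Lemma lebesgue_shift (c : R) (f : R -> \bar R) : measurable_fun setT f ->
  (forall x, (0 <= f x)%E) ->
  (\int[mu]_x f (x + c)%R = \int[mu]_x f x)%E.
Proof.
move=> mf f0.
pose sh (x : measurableTypeR R) : measurableTypeR R := x + c.
have msh : measurable_fun setT sh.
  have H : measurable_fun (setT : set R) (fun x : R => x + c) by apply: measurable_funD.
  exact: H.
have E : (\int[mu]_x f x = \int[pushforward mu sh]_x f x)%E.
  apply: eq_measure_integral => A mA _; apply: lebesgue_measure_unique => //.
  move=> _ [[a b] /= _ <-].
  rewrite /pushforward.
  have -> : sh @^-1` `]a, b]%classic = `]a - c, b - c]%classic.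
    by apply/seteqP; split=> x /=; rewrite !in_itv/= ltrBlDr lerBrDr.
  rewrite !lebesgue_measure_itv/= !lte_fin ltrD2r; case: ifP => // _.
  by rewrite -!EFinB; congr EFin; ring.
by rewrite E ge0_integral_pushforward.
Qed.

(** Integrate along horizontal lines first: on each of them the shear is a
    translation. *)
Lemma area_shear tau (f : R * R -> \bar R) : measurable_fun setT f ->
  (forall z, (0 <= f z)%E) ->
  (\int[area]_z f (z.1 + tau * z.2, z.2)%R = \int[area]_z f z)%E.
Proof.
move=> mf f0; rewrite !area_tonelli2//; last first.
  apply: measurableT_comp => //; apply: measurable_fun_pair => //.
  apply: measurable_funD => //; exact: measurable_funM.
apply: eq_integral => y _; apply: (lebesgue_shift (tau * y) (f := fun x => f (x, y))) => //.
exact: measurable_fun_pair1.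
Qed.
End plane_measure.

(** * Moments on an interval and integration along chords *)

Section moments.
Context {R : realType}.
Local Notation mu := (@lebesgue_measure R).
Implicit Types (a b c x y : R) (f g : R -> R).

Lemma within_segmentX f a b k : {within `[a, b], continuous f} ->
  {within `[a, b], continuous (fun x => f x ^+ k)}.
Proof. by move=> cf x; exact: (cvg_comp _ _ (cf x) (@exprn_continuous R k (f x))). Qed.

Lemma within_segmentD f g a b : {within `[a, b], continuous f} ->
  {within `[a, b], continuous g} -> {within `[a, b], continuous (fun x => f x + g x)}.
Proof. by move=> cf cg x; apply: continuousD; [exact: cf|exact: cg]. Qed.

Lemma within_segmentZ f a b c : {within `[a, b], continuous f} ->
  {within `[a, b], continuous (fun x => c * f x)}.
Proof. by move=> cf x; apply: continuousM; [exact: cst_continuous|exact: cf]. Qed.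

Lemma within_segment_cst a b c : {within `[a, b], continuous (fun _ => c)}.
Proof. by move=> x; exact: cst_continuous. Qed.

Lemma meanD f g a b : {within `[a, b], continuous f} ->
  {within `[a, b], continuous g} ->
  mean (fun x => f x + g x) a b = mean f a b + mean g a b.
Proof.
move=> cf cg; rewrite /mean RintegralD ?mulrDl//.
- exact: within_segment_integrable.
- exact: within_segment_integrable.
Qed.

Lemma meanZ f a b c : {within `[a, b], continuous f} ->
  mean (fun x => c * f x) a b = c * mean f a b.
Proof.
move=> cf; rewrite /mean RintegralZl ?mulrA//; exact: within_segment_integrable.
Qed.

Lemma mean_cst a b c : a < b -> mean (fun _ => c) a b = c.
Proof.
move=> ab; rewrite /mean Rintegral_cst//= lebesgue_measure_itv/= lte_fin ab /=.
by rewrite mulfK// subr_eq0 gt_eqF.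
Qed.

(** Linearity, once for all the polynomials in f that occur below. *)
Lemma mean_cubic f a b (p0 p1 p2 p3 : R) : a < b -> {within `[a, b], continuous f} ->
  mean (fun x => p0 + (p1 * f x ^+ 1 + (p2 * f x ^+ 2 + p3 * f x ^+ 3))) a b =
  p0 + (p1 * moment f a b 1 + (p2 * moment f a b 2 + p3 * moment f a b 3)).
Proof.
move=> ab cf; have cX k := @within_segmentX f a b k cf.
have cZ k p : {within `[a, b], continuous (fun x => p * f x ^+ k)}.
  exact: within_segmentZ.
have c2 := within_segmentD (cZ 2 p2) (cZ 3 p3).
have c1 := within_segmentD (cZ 1%N p1) c2.
rewrite (meanD (@within_segment_cst a b p0) c1) mean_cst//.
by rewrite (meanD (cZ 1%N p1) c2) (meanD (cZ 2 p2) (cZ 3 p3)) !meanZ.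
Qed.

Lemma eq_mean f g a b : f =1 g -> mean f a b = mean g a b.
Proof. by move=> fg; rewrite (_ : f = g)//; apply/funext. Qed.

Lemma moment1 f a b : moment f a b 1 = mean f a b.
Proof. by []. Qed.

(** Both f and - g are negatively skewed and they have the same mean m.  Adding the
    two inequalities leaves a term - 4 * m^3, which has the right sign. *)
Lemma concave_convex_third_moment f g a b : a < b ->
  {within `[a, b], continuous f} -> {within `[a, b], continuous g} ->
  concave_on a b f -> concave_on a b (fun x => - g x) ->
  moment f a b 1 + moment g a b 1 = 0 -> 0 <= moment f a b 1 ->
  moment f a b 3 - moment g a b 3 <=
    3 * moment f a b 1 * (moment f a b 2 + moment g a b 2).
Proof.
move=> ab cf cg vf vg fg0 f0.
have h1 := concave_third_moment ab cf vf.
have cNg : {within `[a, b], continuous (fun x => - g x)}.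
  by move=> x; apply: continuousN; exact: cg.
have := concave_third_moment ab cNg vg.
have E k (p1 p2 p3 : R) : (forall y, (- y) ^+ k = 0 + (p1 * y ^+ 1 + (p2 * y ^+ 2 + p3 * y ^+ 3))) ->
    moment (fun x => - g x) a b k =
    0 + (p1 * moment g a b 1 + (p2 * moment g a b 2 + p3 * moment g a b 3)).
  by move=> H; rewrite -mean_cubic//; apply: eq_mean => x; rewrite H.
rewrite (E 1%N (-1) 0 0); last by move=> y; ring.
rewrite (E 2 0 1 0); last by move=> y; ring.
rewrite (E 3 0 0 (-1)); last by move=> y; ring.
have a3 : 0 <= moment f a b 1 ^+ 3 by rewrite exprn_ge0.
have gE : moment g a b 1 = - moment f a b 1 by lra.
rewrite gE.
move: (moment f a b 1) (moment f a b 2) (moment g a b 2) h1 a3 => m1 m2 n2 h1 a3 h2.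
lra.
Qed.
End moments.

Section body_integrals.
Context {R : realType}.
Local Notation mu := (@lebesgue_measure R).
Implicit Types (K : set (R * R)) (s x y a b c k al be V : R).

Lemma body_measurable K : body K -> measurable K.
Proof. by move=> /body_closed; exact: closed_measurable_plane. Qed.

Lemma body_integral K (phi : R * R -> R) : body K -> measurable_fun setT phi ->
  (forall z, 0 <= phi z) ->
  (\int[area]_(z in K) (phi z)%:E =
   \int[mu]_(s in `[lo K, hi K]) \int[mu]_(y in `[bot K s, top K s]) (phi (s, y))%:E)%E.
Proof.
move=> bK mphi phi0; have mK := body_measurable bK.
rewrite integral_mkcond area_tonelli; last 2 first.
- apply/(measurable_restrictT (EFin \o phi)) => //.
  by apply: measurable_funTS; apply/measurable_EFinP.
- by move=> z; rewrite patchE; case: ifP => // _; rewrite lee_fin.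
rewrite [RHS]integral_mkcond; apply: eq_integral => s _.
rewrite patchE; case: ifPn => [|]; rewrite ?inE/= => sK.
  rewrite [RHS]integral_mkcond; apply: eq_integral => y _.
  rewrite !patchE; congr (if _ then _ else _).
  by apply/idP/idP; rewrite !inE/= => /(chordP y bK sK).
rewrite notin_setE /= in sK.
apply: integral0_eq => y _; rewrite patchE ifF//.
apply/negP; rewrite inE => /(body_lo_hi bK) /= h; apply: sK.
by rewrite in_itv.
Qed.

Lemma integral_sqr_affine k be a b : be != 0 -> a <= b ->
  (\int[mu]_(y in `[a, b]) ((k + be * y) ^+ 2)%:E =
   (((k + be * b) ^+ 3 - (k + be * a) ^+ 3) / (3 * be))%:E)%E.
Proof.
move=> be0; rewrite le_eqVlt => /predU1P[->|ab].
  by rewrite set_itv1 integral_set1 subrr mul0r.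
pose F : R -> R := (3 * be)^-1 *: ((cst k + be *: id) ^+ 3).
have dF (x : R) : is_derive x 1 F ((k + be * x) ^+ 2).
  apply: is_derive_eq; rewrite /= add0r.
  rewrite !fctE /GRing.scale/=; field; exact: be0.
have FE x : F x = (k + be * x) ^+ 3 / (3 * be).
  by rewrite /F !fctE /GRing.scale/= mulrC.
rewrite (@continuous_FTC2 _ _ F)//.
- by rewrite -EFinB !FE mulrBl.
- apply: (within_segmentX (k := 2)); apply: within_segmentD.
    exact: within_segment_cst.
  by apply: within_segmentZ; apply: continuous_subspaceT => x; exact: cvg_id.
- split.
  + by move=> x _; apply: ex_derive.
  + apply/cvg_at_right_filter/differentiable_continuous/derivable1_diffP.
    exact: ex_derive.
  + apply/cvg_at_left_filter/differentiable_continuous/derivable1_diffP.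
    exact: ex_derive.
- by move=> x _; rewrite derive1E derive_val.
Qed.
End body_integrals.

(** * Variance along chords in one direction *)

Section chord_variance.
Context {R : realType}.
Local Notation mu := (@lebesgue_measure R).
Implicit Types (K : set (R * R)) (s x y a b c k al be V : R).

Lemma integral_segmentE (f : R -> R) a b : a < b -> {within `[a, b], continuous f} ->
  (\int[mu]_(x in `[a, b]) (f x)%:E = ((b - a) * mean f a b)%:E)%E.
Proof.
move=> ab cf; rewrite /mean mulrC divfK ?subr_eq0 ?gt_eqF// /Rintegral fineK//.
by apply: integrable_fin_num => //; exact: within_segment_integrable.
Qed.

Definition chord_top K al be s : R := al * s + be * top K s.
Definition chord_bot K al be s : R := al * s + be * bot K s.

Lemma within_segment_id a b c : {within `[a, b], continuous (fun x => c * x)}.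
Proof. by apply: within_segmentZ; apply: continuous_subspaceT => x; exact: cvg_id. Qed.

Lemma chord_top_continuous K al be : body K ->
  {within `[lo K, hi K], continuous (chord_top K al be)}.
Proof.
move=> bK; apply: within_segmentD; first exact: within_segment_id.
by apply: within_segmentZ; exact: top_continuous.
Qed.

Lemma chord_bot_continuous K al be : body K ->
  {within `[lo K, hi K], continuous (chord_bot K al be)}.
Proof.
move=> bK; apply: within_segmentD; first exact: within_segment_id.
by apply: within_segmentZ; exact: bot_continuous.
Qed.

Lemma area_chords K : body K ->
  area K = ((hi K - lo K) * mean (fun s => top K s - bot K s) (lo K) (hi K))%:E.
Proof.
move=> bK; have := @body_integral R K (cst 1) bK; rewrite /= integral_cst; last first.
  exact: body_measurable.
rewrite mul1e => ->//.
rewrite -integral_segmentE; last 2 first.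
- exact: lo_lt_hi.
- apply: within_segmentD; first exact: top_continuous.
  by move=> x; apply: continuousN; exact: bot_continuous.
apply: eq_integral => s; rewrite inE/= => sK.
rewrite integral_cst//= mul1e lebesgue_measure_itv/= lte_fin.
have := bot_le_top bK sK; rewrite le_eqVlt => /predU1P[->|->//].
by rewrite ltxx subrr.
Qed.

(** Along the chord over s the form al * x + be * y is affine in y with slope be, so
    its square integrates to a difference of cubes of its values at the two ends. *)
Lemma area_second_moment_chords K al be c : body K -> be != 0 ->
  (\int[area]_(z in K) ((al * z.1 + be * z.2 - c) ^+ 2)%:E =
   ((hi K - lo K) / (3 * be) *
     (mean (fun s => (chord_top K al be s - c) ^+ 3) (lo K) (hi K) -
      mean (fun s => (chord_bot K al be s - c) ^+ 3) (lo K) (hi K)))%:E)%E.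
Proof.
move=> bK be0.
rewrite body_integral//; last 2 first.
- apply: measurable_funX; apply: measurable_funB => //.
  by apply: measurable_funD; exact: measurable_funM.
- by move=> z; exact: sqr_ge0.
have lh := lo_lt_hi bK.
have ct : {within `[lo K, hi K], continuous (fun s => (chord_top K al be s - c) ^+ 3)}.
  apply: (within_segmentX (k := 3)); apply: within_segmentD.
    exact: chord_top_continuous.
  exact: within_segment_cst.
have cb : {within `[lo K, hi K], continuous (fun s => (chord_bot K al be s - c) ^+ 3)}.
  apply: (within_segmentX (k := 3)); apply: within_segmentD.
    exact: chord_bot_continuous.
  exact: within_segment_cst.
have cNb : {within `[lo K, hi K], continuous (fun s => -1 * (chord_bot K al be s - c) ^+ 3)}.
  exact: within_segmentZ.
have ctb := within_segmentD ct cNb.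
have -> : (hi K - lo K) / (3 * be) *
     (mean (fun s => (chord_top K al be s - c) ^+ 3) (lo K) (hi K) -
      mean (fun s => (chord_bot K al be s - c) ^+ 3) (lo K) (hi K)) =
  (hi K - lo K) * mean (fun s => (3 * be)^-1 * ((chord_top K al be s - c) ^+ 3 +
     -1 * (chord_bot K al be s - c) ^+ 3)) (lo K) (hi K).
  by rewrite meanZ// (meanD ct cNb) meanZ//; ring.
rewrite -integral_segmentE//; last exact: within_segmentZ.
apply: eq_integral => s; rewrite inE/= => sK.
transitivity (\int[mu]_(y in `[bot K s, top K s]) (((al * s - c) + be * y) ^+ 2)%:E)%E.
  by apply: eq_integral => y _; congr (_ ^+ 2)%:E; ring.
rewrite integral_sqr_affine//; last exact: bot_le_top.
by rewrite /chord_top /chord_bot; congr EFin; field.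
Qed.

Lemma affine_concave_on (f : R -> R) a b al be c : 0 <= be -> concave_on a b f ->
  concave_on a b (fun s => al * s + be * f s + c).
Proof.
move=> be0 cf x y t xab yab t01; have := cf _ _ _ xab yab t01.
move=> /(ler_wpM2l be0); move: (f _) (f x) (f y) => p q r h.
by move: h; lra.
Qed.

(** Take the origin half-way between the means of the form at the upper and at the
    lower ends.  As be is positive, the values f at the upper ends are concave and
    the values g at the lower ends are convex, with means m and - m.  The area is
    proportional to 2 * m and the second moment to a third of the third moment of f
    less that of g; [concave_convex_third_moment] compares the two, and m cancels.
    Replacing the origin by another point c increases the right-hand side. *)
Lemma chord_variance_pos K al be V : body K -> 0 < be -> (0 < area K)%E ->
  (forall c, (V%:E * area K <=
     \int[area]_(z in K) ((al * z.1 + be * z.2 - c) ^+ 2)%:E)%E) ->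
  forall c, 2 * V <=
    mean (fun s => (chord_top K al be s - c) ^+ 2) (lo K) (hi K) +
    mean (fun s => (chord_bot K al be s - c) ^+ 2) (lo K) (hi K).
Proof.
move=> bK be0 K0 VK c; have lh := lo_lt_hi bK.
have w0 : 0 < hi K - lo K by rewrite subr_gt0.
pose U := chord_top K al be; pose W := chord_bot K al be.
have cU : {within `[lo K, hi K], continuous U} := chord_top_continuous (al:=al) (be:=be) bK.
have cW : {within `[lo K, hi K], continuous W} := chord_bot_continuous (al:=al) (be:=be) bK.
pose E f := mean f (lo K) (hi K).
(* the centre of the two families of chord ends *)
pose c0 := (E U + E W) / 2.
pose f s := U s - c0; pose g s := W s - c0.
have cf : {within `[lo K, hi K], continuous f}.
  by apply: within_segmentD => //; exact: within_segment_cst.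
have cg : {within `[lo K, hi K], continuous g}.
  by apply: within_segmentD => //; exact: within_segment_cst.
have vf : concave_on (lo K) (hi K) f.
  by apply: affine_concave_on; [exact: ltW|exact: top_concave].
have vg : concave_on (lo K) (hi K) (fun s => - g s).
  have := @affine_concave_on (fun s => - bot K s) (lo K) (hi K) (- al) be c0 (ltW be0) (bot_convex bK).
  rewrite (_ : (fun s => - g s) = (fun s => - al * s + be * (- bot K s) + c0))//.
  by apply/funext => s; rewrite /g /W /chord_bot; ring.
have m1f : moment f (lo K) (hi K) 1 = E U - c0.
  by rewrite moment1 (meanD cU (@within_segment_cst _ _ _ (- c0))) mean_cst.
have m1g : moment g (lo K) (hi K) 1 = E W - c0.
  by rewrite moment1 (meanD cW (@within_segment_cst _ _ _ (- c0))) mean_cst.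
have areaE : area K = ((hi K - lo K) * (2 * moment f (lo K) (hi K) 1 / be))%:E.
  rewrite area_chords// m1f; congr (_ * _)%:E.
  have cNW := @within_segmentZ R W _ _ (-1) cW.
  have -> : 2 * (E U - c0) / be = be^-1 * (E U + -1 * E W) by rewrite /c0; field; exact: lt0r_neq0.
  rewrite -[-1 * E W]meanZ// -(meanD cU cNW) -meanZ; last exact: within_segmentD.
  by apply: eq_mean => s; rewrite /U /W /chord_top /chord_bot; field; exact: lt0r_neq0.
have a0 : 0 < moment f (lo K) (hi K) 1.
  move: K0; rewrite areaE lte_fin pmulr_rgt0// pmulr_lgt0 ?invr_gt0// pmulr_rgt0//.
have fg0 : moment f (lo K) (hi K) 1 + moment g (lo K) (hi K) 1 = 0.
  by rewrite m1f m1g /c0; field.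
have h3 := concave_convex_third_moment lh cf cg vf vg fg0 (ltW a0).
have := VK c0; rewrite area_second_moment_chords ?lt0r_neq0// areaE -EFinM lee_fin.
rewrite -/U -/W -/(moment f (lo K) (hi K) 3) -/(moment g (lo K) (hi K) 3).
have expand (h : R -> R) (d : R) : {within `[lo K, hi K], continuous h} ->
    E (fun s => (h s - d) ^+ 2) = d ^+ 2 + (- (2 * d) * moment h (lo K) (hi K) 1
      + (1 * moment h (lo K) (hi K) 2 + 0 * moment h (lo K) (hi K) 3)).
  move=> ch; rewrite -mean_cubic//; apply: eq_mean => s; ring.
have EU : E (fun s => (U s - c) ^+ 2) = E (fun s => (f s - (c - c0)) ^+ 2).
  by apply: eq_mean => s; rewrite /f; congr (_ ^+ 2); ring.
have EW : E (fun s => (W s - c) ^+ 2) = E (fun s => (g s - (c - c0)) ^+ 2).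
  by apply: eq_mean => s; rewrite /g; congr (_ ^+ 2); ring.
rewrite -/(E _) -/(E (fun s => (W s - c) ^+ 2)) EU EW !expand//.
have gE : moment g (lo K) (hi K) 1 = - moment f (lo K) (hi K) 1 by lra.
rewrite gE.
move: (moment f _ _ 1) (moment f _ _ 2) (moment g _ _ 2) (moment f _ _ 3) (moment g _ _ 3)
  a0 h3 => a m2 n2 m3 n3 a0 h3 h4.
have h5 : V * a <= a * ((m2 + n2) / 2).
  have k0 : 0 < (hi K - lo K) * 2 / be by rewrite divr_gt0// mulr_gt0.
  rewrite -(ler_pM2l k0).
  have -> : (hi K - lo K) * 2 / be * (V * a) = V * ((hi K - lo K) * (2 * a / be)) by field; exact: lt0r_neq0.
  apply: le_trans h4 _.
  have -> : (hi K - lo K) / (3 * be) * (m3 - n3) = (hi K - lo K) * 2 / be * ((m3 - n3) / 6).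
    by field; exact: lt0r_neq0.
  by rewrite ler_pM2l//; lra.
rewrite mulrC ler_pM2l// in h5.
by have := sqr_ge0 (c - c0); lra.
Qed.

(** Changing the sign of the form, and of c, changes the sign of be. *)
Lemma chord_variance_le K al be V : body K -> be != 0 -> (0 < area K)%E ->
  (forall c, (V%:E * area K <=
     \int[area]_(z in K) ((al * z.1 + be * z.2 - c) ^+ 2)%:E)%E) ->
  forall c, 2 * V <=
    mean (fun s => (chord_top K al be s - c) ^+ 2) (lo K) (hi K) +
    mean (fun s => (chord_bot K al be s - c) ^+ 2) (lo K) (hi K).
Proof.
move=> bK be0 K0 VK c; have [be1|be1] := ltP 0 be; first exact: chord_variance_pos.
have be2 : 0 < - be by rewrite oppr_gt0 lt_neqAle be0 be1.
have E x y t : (- al * x + - be * y - t) ^+ 2 = (al * x + be * y - (- t)) ^+ 2 by ring.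
have VK' t : (V%:E * area K <=
     \int[area]_(z in K) ((- al * z.1 + - be * z.2 - t) ^+ 2)%:E)%E.
  apply: le_trans (VK (- t)) _; rewrite le_eqVlt; apply/orP; left; apply/eqP.
  by apply: eq_integral => z _; rewrite E.
have := chord_variance_pos bK be2 K0 VK' (- c); congr (_ <= _ + _).
  by apply: eq_mean => s; rewrite /chord_top E opprK.
by apply: eq_mean => s; rewrite /chord_bot E opprK.
Qed.
End chord_variance.

(** * The gauge of a body *)

Section radial_parametrization.
Context {R : realType}.
Implicit Types (K : set (R * R)) (o p q v w : R * R) (s t c l e : R).

Definition gauge_set K o v : set R :=
  [set l | 0 < l /\ K (o.1 + v.1 / l, o.2 + v.2 / l)].

(** The Minkowski functional of K centred at o. *)
Definition gauge K o v : R := inf (gauge_set K o v).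

Section gauge_theory.
Variables (K : set (R * R)) (o : R * R).
Hypotheses (bK : body K) (io : interior K o).

Let Ko : K o := interior_subset io.

Let vK p q t : K p -> K q -> 0 <= t <= 1 -> K (segment_pt t p q).
Proof. by case: bK => _ + _; apply. Qed.

Lemma gauge_set_up v l c : gauge_set K o v l -> l <= c -> gauge_set K o v c.
Proof.
move=> [l0 Kl] lc; have c0 : 0 < c by apply: lt_le_trans lc.
split=> //; have t01 : 0 <= l / c <= 1 by apply/andP; split; [rewrite divr_ge0// ltW|rewrite ler_pdivrMr// mul1r].
have := vK Kl Ko t01; rewrite /segment_pt /=.
congr (K (_, _)); field; by rewrite !lt0r_neq0.
Qed.

Lemma gauge_set_add v w l c : gauge_set K o v l -> gauge_set K o w c ->
  gauge_set K o (v.1 + w.1, v.2 + w.2) (l + c).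
Proof.
move=> [l0 Kl] [c0 Kc]; have lc0 : 0 < l + c by exact: addr_gt0.
split=> //; have t01 : 0 <= l / (l + c) <= 1.
  by apply/andP; split; [rewrite divr_ge0// ltW|rewrite ler_pdivrMr// mul1r lerDl ltW].
have := vK Kl Kc t01; rewrite /segment_pt /=.
congr (K (_, _)); field; by rewrite !lt0r_neq0.
Qed.

Lemma gauge_set_ball : exists2 C : R, 0 < C &
  forall v l, C * (`|v.1| + `|v.2|) < l -> gauge_set K o v l.
Proof.
have [e e0 H] := (interiorP K o).1 io.
exists e^-1; first by rewrite invr_gt0.
move=> v l vl.
have l0 : 0 < l by apply: le_lt_trans vl; rewrite mulr_ge0 ?addr_ge0// invr_ge0 ltW.
split=> //; rewrite mulrC ltr_pdivrMr// in vl.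
apply: H => /=; rewrite opprD addrA subrr sub0r normrN normrM normfV (gtr0_norm l0) ltr_pdivrMr//.
  by apply: le_lt_trans (_ : _ <= `|v.1| + `|v.2|) _; [rewrite lerDl|rewrite mulrC].
by apply: le_lt_trans (_ : _ <= `|v.1| + `|v.2|) _; [rewrite lerDr|rewrite mulrC].
Qed.

Lemma gauge_set_neq0 v : gauge_set K o v !=set0.
Proof.
have [C C0 H] := gauge_set_ball; exists (C * (`|v.1| + `|v.2|) + 1).
by apply: H; rewrite ltrDl.
Qed.

Lemma gauge_set_lb v : has_lbound (gauge_set K o v).
Proof. by exists 0 => l [/ltW]. Qed.

Lemma gauge_le v l : gauge_set K o v l -> gauge K o v <= l.
Proof. by move=> vl; apply: ge_inf => //; exact: gauge_set_lb. Qed.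

Lemma gauge_lt v l : gauge K o v < l -> gauge_set K o v l.
Proof.
move=> vl; have vl0 : 0 < l - gauge K o v by rewrite subr_gt0.
have hinf : has_inf (gauge_set K o v).
  by split; [exact: gauge_set_neq0|exact: gauge_set_lb].
have [c vc cl] := inf_adherent vl0 hinf; rewrite -/(gauge K o v) in cl.
by apply: gauge_set_up vc _; rewrite addrC subrK in cl; exact: ltW.
Qed.

Lemma gauge_add v w : gauge K o (v.1 + w.1, v.2 + w.2) <= gauge K o v + gauge K o w.
Proof.
apply/ler_addgt0Pr => e e0.
have hv : gauge_set K o v (gauge K o v + e / 2) by apply: gauge_lt; rewrite ltrDl divr_gt0.
have hw : gauge_set K o w (gauge K o w + e / 2) by apply: gauge_lt; rewrite ltrDl divr_gt0.
by have := gauge_le (gauge_set_add hv hw); lra.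
Qed.

(** The gauge is subadditive, and a ball around o inside K bounds it by a multiple
    of the norm. *)
Lemma gauge_lipschitz : exists2 C : R, 0 < C & forall v w,
  `|gauge K o v - gauge K o w| <= C * (`|v.1 - w.1| + `|v.2 - w.2|).
Proof.
have [C C0 H] := gauge_set_ball; exists C => //.
have A v : gauge K o v <= C * (`|v.1| + `|v.2|).
  by apply/ler_addgt0Pr => e e0; apply/gauge_le/H; rewrite ltrDl.
have B v w : gauge K o v - gauge K o w <= C * (`|v.1 - w.1| + `|v.2 - w.2|).
  have := gauge_add (v.1 - w.1, v.2 - w.2) w; rewrite /= !subrK -surjective_pairing.
  by have := A (v.1 - w.1, v.2 - w.2); rewrite /=; lra.
move=> v w; rewrite ler_norml B andbT lerNl opprB.
by rewrite (distrC v.1) (distrC v.2) B.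
Qed.

(** K is bounded, so it does not contain a half-line. *)
Lemma gauge_pos v : v != 0 -> 0 < gauge K o v.
Proof.
move=> v0; have [cK _ _] := bK.
have [M [Mr HM]] := compact_bounded cK.
pose D := `|M| + 1; have D0 : 0 < D by rewrite ltr_wpDl.
have KD p : K p -> `|p.1| <= D /\ `|p.2| <= D.
  move=> Kp; have : `|p| <= D by apply: HM => //; rewrite (le_lt_trans (ler_norm _))// ltrDl.
  by rewrite prod_normE ge_max => /andP[].
have [Do1 Do2] := KD _ Ko.
have vpos : 0 < `|v.1| + `|v.2|.
  rewrite lt_neqAle addr_ge0// andbT eq_sym paddr_eq0// !normr_eq0.
  by apply: contra v0 => /andP[/eqP h1 /eqP h2]; rewrite [v]surjective_pairing h1 h2.
have : (`|v.1| + `|v.2|) / (4 * D) <= gauge K o v.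
  apply: lb_le_inf; first exact: gauge_set_neq0.
  move=> l [l0 Kl]; have [h1 h2] := KD _ Kl; rewrite /= in h1 h2.
  rewrite ler_pdivrMr ?mulr_gt0//.
  have A x y : `|x + y / l| <= D -> `|x| <= D -> `|y| <= l * (2 * D).
    move=> xy x1; rewrite -ler_pdivrMl// mulrC -{1}(gtr0_norm l0) -normfV -normrM.
    have -> : y / l = (x + y / l) - x by ring.
    by apply: le_trans (ler_normB _ _) _; lra.
  by have := A _ _ h1 Do1; have := A _ _ h2 Do2; lra.
by apply: lt_le_trans; rewrite divr_gt0// mulr_gt0.
Qed.

Lemma gauge_scale c v : 0 < c -> gauge K o (c * v.1, c * v.2) = c * gauge K o v.
Proof.
have A k w : 0 < k -> gauge K o (k * w.1, k * w.2) <= k * gauge K o w.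
  move=> k0; apply/ler_addgt0Pr => e e0.
  have [h1 h2] : gauge_set K o w (gauge K o w + e / k).
    by apply: gauge_lt; rewrite ltrDl divr_gt0.
  apply: gauge_le; have -> : k * gauge K o w + e = k * (gauge K o w + e / k).
    by rewrite mulrDr mulrCA divff ?mulr1// lt0r_neq0.
  split; first exact: mulr_gt0.
  by rewrite /= -!mulf_div !divff ?mul1r// lt0r_neq0.
move=> c0; apply/eqP; rewrite eq_le A//=.
have := A c^-1 (c * v.1, c * v.2); rewrite invr_gt0 => /(_ c0) /=.
rewrite !mulKf ?lt0r_neq0// -surjective_pairing.
by rewrite -(ler_pM2l c0) mulrA divff ?lt0r_neq0// mul1r.
Qed.

(** A point of gauge less than 1 lies on a segment from o to a point of K further
    out, hence is interior; conversely an interior point can be moved outwards a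
    little along its ray without leaving K. *)
Lemma boundary_gauge v : boundary K (o.1 + v.1, o.2 + v.2) <-> gauge K o v = 1.
Proof.
split=> [bv|v1].
  have Kv := boundary_sub bK bv; case: bv => _ iv.
  apply/eqP; rewrite eq_le; apply/andP; split.
    by apply: gauge_le; split=> //; rewrite !divr1.
  rewrite leNgt; apply/negP => h; apply: iv.
  pose l := (gauge K o v + 1) / 2.
  have [l0 Kl] : gauge_set K o v l by apply: gauge_lt; rewrite /l; lra.
  have l1 : l < 1 by rewrite /l; lra.
  have t01 : 0 < 1 - l <= 1 by apply/andP; split; lra.
  have := interior_segment bK io Kl t01; rewrite /segment_pt /=.
  by congr (interior K (_, _)); field; rewrite lt0r_neq0.
pose D := 1 + (`|v.1| + `|v.2|).
have D0 : 0 < D by rewrite ltr_wpDr ?addr_ge0.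
split.
  have [Kv|nKv] := pselect (K (o.1 + v.1, o.2 + v.2)); first exact: subset_closure.
  have oK : open (~` K) by rewrite openC; exact: body_closed.
  have /interiorP[e e0 H] : interior (~` K) (o.1 + v.1, o.2 + v.2).
    by rewrite (interior_id _).1.
  pose l := 1 + e / D.
  have eD : 0 < e / D by rewrite divr_gt0.
  have l1 : 1 < l by rewrite ltrDl.
  have l0 : 0 < l by lra.
  have [_ Kl] : gauge_set K o v l by apply: gauge_lt; rewrite v1.
  have A x : `|x| < D -> `|x - x / l| < e.
    move=> xD; have -> : x - x / l = x * (e / D) / l.
      have -> : e / D = l - 1 by rewrite /l addrC addKr.
      by field; exact: lt0r_neq0.
    rewrite normrM normfV (gtr0_norm l0) ltr_pdivrMr// normrM (gtr0_norm eD).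
    have h1 : `|x| * (e / D) < e by rewrite mulrA ltr_pdivrMr// [`|x| * e]mulrC ltr_pM2l.
    by apply: lt_trans h1 _; rewrite ltr_pMr.
  case: (H (o.1 + v.1 / l, o.2 + v.2 / l)) => //=; rewrite opprD addrACA subrr add0r; apply: A.
    by rewrite /D; have := normr_ge0 v.2; lra.
  by rewrite /D; have := normr_ge0 v.1; lra.
move=> /interiorP[e e0 H].
pose k := e / (2 * D); have k0 : 0 < k by rewrite divr_gt0// mulr_gt0.
have k1 : 0 < 1 + k by lra.
have : gauge_set K o v (1 + k)^-1.
  split; first by rewrite invr_gt0.
  have A x : `|x| < D -> `|x * k| < e.
    move=> xD; rewrite normrM (gtr0_norm k0) /k mulrA ltr_pdivrMr ?mulr_gt0//.
    by rewrite [`|x| * e]mulrC ltr_pM2l//; lra.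
  rewrite invrK; apply: H => /=; rewrite opprD addrACA subrr add0r mulrDr mulr1 opprD addrA subrr sub0r normrN; apply: A.
    by rewrite /D; have := normr_ge0 v.2; lra.
  by rewrite /D; have := normr_ge0 v.1; lra.
move=> /gauge_le; rewrite v1 -(ler_pM2l k1) mulr1 divff ?lt0r_neq0//; lra.
Qed.
End gauge_theory.
End radial_parametrization.

(** * Radial parametrization of the boundary *)

Section boundary_curve.
Context {R : realType}.
Implicit Types (K : set (R * R)) (o p q v w : R * R) (s t c l e : R).

(** The unit circle of the norm |x| + |y|, run anticlockwise from (1, 0) in time 4.
    It stands for the circle of directions, with an explicit Lipschitz
    parametrization and inverse. *)
Definition diamond t : R * R := (`|t - 2| - 1, t - `|t - 1| + `|t - 3| - 2).

Lemma diamond_norm t : 0 <= t <= 4 -> `|(diamond t).1| + `|(diamond t).2| = 1.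
Proof.
move=> /andP[t0 t4]; rewrite /diamond /=.
have [h1|h1] := leP 1 t; have [h2|h2] := leP 2 t; have [h3|h3] := leP 3 t; try lra.
- rewrite (ger0_norm (x := t - 2)) ?(ger0_norm (x := t - 1)) ?(ger0_norm (x := t - 3)); try lra.
  rewrite (ger0_norm (x := t - 2 - 1)) ?(ler0_norm (x := t - (t - 1) + (t - 3) - 2)); lra.
- rewrite (ger0_norm (x := t - 2)) ?(ger0_norm (x := t - 1)) ?(ltr0_norm (x := t - 3)); try lra.
  rewrite (ler0_norm (x := t - 2 - 1)) ?(ler0_norm (x := t - (t - 1) - (t - 3) - 2)); lra.
- rewrite (ltr0_norm (x := t - 2)) ?(ger0_norm (x := t - 1)) ?(ltr0_norm (x := t - 3)); try lra.
  rewrite (ler0_norm (x := - (t - 2) - 1)) ?(ger0_norm (x := t - (t - 1) - (t - 3) - 2)); lra.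
- rewrite (ltr0_norm (x := t - 2)) ?(ltr0_norm (x := t - 1)) ?(ltr0_norm (x := t - 3)); try lra.
  rewrite (ger0_norm (x := - (t - 2) - 1)) ?(ger0_norm (x := t - - (t - 1) - (t - 3) - 2)); lra.
Qed.

(** Inverse of [diamond]; the sign of the ordinate tells the two halves of the
    circle apart. *)
Definition diamond_arg v : R := if 0 <= v.2 then 1 - v.1 else 3 + v.1.

Lemma diamondK t : 0 <= t < 4 -> diamond_arg (diamond t) = t.
Proof.
move=> /andP[t0 t4]; rewrite /diamond_arg /diamond /=.
have [h1|h1] := leP 1 t; have [h2|h2] := leP 2 t; have [h3|h3] := leP 3 t; try lra.
- rewrite (ger0_norm (x := t - 2)) ?(ger0_norm (x := t - 1)) ?(ger0_norm (x := t - 3)); try lra.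
  by case: leP => ?; lra.
- rewrite (ger0_norm (x := t - 2)) ?(ger0_norm (x := t - 1)) ?(ltr0_norm (x := t - 3)); try lra.
  by case: leP => ?; lra.
- rewrite (ltr0_norm (x := t - 2)) ?(ger0_norm (x := t - 1)) ?(ltr0_norm (x := t - 3)); try lra.
  by case: leP => ?; lra.
- rewrite (ltr0_norm (x := t - 2)) ?(ltr0_norm (x := t - 1)) ?(ltr0_norm (x := t - 3)); try lra.
  by case: leP => ?; lra.
Qed.

Lemma diamond_argK v : `|v.1| + `|v.2| = 1 ->
  0 <= diamond_arg v < 4 /\ diamond (diamond_arg v) = v.
Proof.
case: v => x y /=; rewrite /diamond_arg /diamond /=.
have [y0|y0] := leP 0 y; have [x0|x0] := leP 0 x.
- rewrite (ger0_norm x0) (ger0_norm y0) => h.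
  have -> : `|1 - x - 2| = - (1 - x - 2) by rewrite ler0_norm//; lra.
  have -> : `|1 - x - 1| = - (1 - x - 1) by rewrite ler0_norm//; lra.
  have -> : `|1 - x - 3| = - (1 - x - 3) by rewrite ler0_norm//; lra.
  by split; [apply/andP; split; lra|congr pair; lra].
- rewrite (ltr0_norm x0) (ger0_norm y0) => h.
  have -> : `|1 - x - 2| = - (1 - x - 2) by rewrite ler0_norm//; lra.
  have -> : `|1 - x - 1| = 1 - x - 1 by rewrite ger0_norm//; lra.
  have -> : `|1 - x - 3| = - (1 - x - 3) by rewrite ler0_norm//; lra.
  by split; [apply/andP; split; lra|congr pair; lra].
- rewrite (ger0_norm x0) (ltr0_norm y0) => h.
  have -> : `|3 + x - 2| = 3 + x - 2 by rewrite ger0_norm//; lra.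
  have -> : `|3 + x - 1| = 3 + x - 1 by rewrite ger0_norm//; lra.
  have -> : `|3 + x - 3| = 3 + x - 3 by rewrite ger0_norm//; lra.
  by split; [apply/andP; split; lra|congr pair; lra].
- rewrite (ltr0_norm x0) (ltr0_norm y0) => h.
  have -> : `|3 + x - 2| = 3 + x - 2 by rewrite ger0_norm//; lra.
  have -> : `|3 + x - 1| = 3 + x - 1 by rewrite ger0_norm//; lra.
  have -> : `|3 + x - 3| = - (3 + x - 3) by rewrite ler0_norm//; lra.
  by split; [apply/andP; split; lra|congr pair; lra].
Qed.

Lemma diamond_lipschitz s t :
  `|(diamond s).1 - (diamond t).1| + `|(diamond s).2 - (diamond t).2| <= 4 * `|s - t|.
Proof.
rewrite /diamond /=.
have A c : `| `|s - c| - `|t - c| | <= `|s - t|.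
  by apply: le_trans (ler_dist_dist _ _) _; rewrite opprB addrA subrK.
have -> : `|s - 2| - 1 - (`|t - 2| - 1) = `|s - 2| - `|t - 2| by ring.
have -> : s - `|s - 1| + `|s - 3| - 2 - (t - `|t - 1| + `|t - 3| - 2) =
  (s - t) - (`|s - 1| - `|t - 1|) + (`|s - 3| - `|t - 3|) by ring.
have h1 := ler_normD ((s - t) - (`|s - 1| - `|t - 1|)) (`|s - 3| - `|t - 3|).
have h2 := ler_normB (s - t) (`|s - 1| - `|t - 1|).
by have := A 1; have := A 2; have := A 3; lra.
Qed.

Lemma lipschitz_within (f : R -> R) a b (C : R) :
  (forall s t, `|f s - f t| <= C * `|s - t|) -> {within `[a, b], continuous f}.
Proof.
move=> fC; apply: continuous_subspaceT => x.
apply/cvgrPdist_lt => e e0.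
have C0 : 0 < `|C| + 1 by rewrite ltr_wpDl.
apply/nbhs_ballP; exists (e / (`|C| + 1)) => /=; first by rewrite divr_gt0.
move=> y; rewrite /ball/= ltr_pdivlMr// => xy.
apply: le_lt_trans (fC x y) (le_lt_trans _ xy).
by rewrite mulrC ler_wpM2l// (le_trans (ler_norm _))// lerDl.
Qed.

(** Divide the directions by their gauge: this projects the diamond radially onto
    the boundary, from an interior point. *)
Lemma boundary_curve K : body K -> exists gam : R -> R * R,
  [/\ {within `[0, 4], continuous (fun t => (gam t).1)},
      {within `[0, 4], continuous (fun t => (gam t).2)},
      gam 0 = gam 4,
      {in `[0, 4[ &, injective gam} &
      boundary K = gam @` `[0, 4[%classic].
Proof.
move=> bK; have [_ _ [ctr io]] := bK.
pose g t := gauge K ctr (diamond t).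
have g0 t : 0 <= t <= 4 -> 0 < g t.
  move=> /diamond_norm h; apply: gauge_pos => //; apply/eqP => E.
  by move: h; rewrite E /= normr0 addr0 => /eqP; rewrite eq_sym oner_eq0.
pose gam t := (ctr.1 + (diamond t).1 / g t, ctr.2 + (diamond t).2 / g t).
have cg : {within `[0, 4], continuous g}.
  have [C C0 H] := gauge_lipschitz bK io.
  apply: (lipschitz_within (C := C * 4)) => s t.
  apply: le_trans (H _ _) _; rewrite -mulrA ler_pM2l//; exact: diamond_lipschitz.
have cq (f : R -> R) c : {within `[0, 4], continuous f} ->
    {within `[0, 4], continuous (fun t => c + f t / g t)}.
  move=> cf; apply/subspace_continuousP => x x04.
  apply: cvgD; first exact: cvg_cst.
  apply: cvgM; first by move/subspace_continuousP: cf; exact.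
  apply: cvgV; first by rewrite lt0r_neq0// g0.
  by move/subspace_continuousP: cg; exact.
have cd1 : {within `[0, 4], continuous (fun t => (diamond t).1)}.
  apply: (lipschitz_within (C := 4)) => s t; apply: le_trans (diamond_lipschitz s t).
  by rewrite lerDl.
have cd2 : {within `[0, 4], continuous (fun t => (diamond t).2)}.
  apply: (lipschitz_within (C := 4)) => s t; apply: le_trans (diamond_lipschitz s t).
  by rewrite lerDr.
exists gam; split.
- exact: cq.
- exact: cq.
- have E : diamond 0 = diamond 4.
    rewrite /diamond; congr pair.
      by rewrite (ltr0_norm (x := 0 - 2)) ?(gtr0_norm (x := 4 - 2)); lra.
    rewrite (ltr0_norm (x := 0 - 1)) ?(gtr0_norm (x := 4 - 1)); try lra.
    by rewrite (ltr0_norm (x := 0 - 3)) ?(gtr0_norm (x := 4 - 3)); lra.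
  by rewrite /gam /g E.
- move=> s t; rewrite !in_itv/= => s04 t04 /pair_equal_spec[/addrI E1 /addrI E2].
  have s4 : 0 <= s <= 4 by case/andP: s04 => -> /ltW ->.
  have t4 : 0 <= t <= 4 by case/andP: t04 => -> /ltW ->.
  have gs := g0 _ s4; have gt := g0 _ t4.
  have F1 : (diamond s).1 = (diamond t).1 / g t * g s by rewrite -E1 divfK// lt0r_neq0.
  have F2 : (diamond s).2 = (diamond t).2 / g t * g s by rewrite -E2 divfK// lt0r_neq0.
  have : g s / g t = 1.
    have := diamond_norm s4; rewrite F1 F2 -!mulrA !normrM -mulrDl diamond_norm// mul1r.
    by rewrite -normrM mulrC gtr0_norm// divr_gt0.
  move=> st1; have Est : diamond s = diamond t.
    by rewrite [LHS]surjective_pairing F1 F2 -!mulrA ![(g t)^-1 * _]mulrC st1 !mulr1 -surjective_pairing.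
  by rewrite -(diamondK s04) Est diamondK.
apply/seteqP; split=> [b bb|_ [t t04 <-]]; last first.
  have t4 : 0 <= t <= 4 by move: t04; rewrite /= in_itv/= => /andP[-> /ltW ->].
  have gt := g0 _ t4.
  apply/(boundary_gauge bK io ((diamond t).1 / g t, (diamond t).2 / g t)).
  have gt' : 0 < (g t)^-1 by rewrite invr_gt0.
  by rewrite mulrC [_.2 / _]mulrC gauge_scale// -/(g t) mulVf// lt0r_neq0.
pose v := (b.1 - ctr.1, b.2 - ctr.2).
have vE : (ctr.1 + v.1, ctr.2 + v.2) = b by rewrite /= !addrA ![ctr.1 + _]addrC ![ctr.2 + _]addrC !addrK -surjective_pairing.
have gv : gauge K ctr v = 1 by apply/(boundary_gauge bK io); rewrite vE.
pose m := `|v.1| + `|v.2|.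
have m0 : 0 < m.
  rewrite lt_neqAle addr_ge0// andbT eq_sym; apply/eqP => m0.
  have [C C0 H] := gauge_lipschitz bK io.
  have := gauge_scale bK io v (ltr0Sn R 1).
  have /andP[/eqP v1 /eqP v2] : (`|v.1| == 0) && (`|v.2| == 0) by rewrite -paddr_eq0//; apply/eqP.
  move/eqP: v1; rewrite normr_eq0 => /eqP v1; move/eqP: v2; rewrite normr_eq0 => /eqP v2.
  have -> : (1 *+ 2 * v.1, 1 *+ 2 * v.2) = v by rewrite [RHS]surjective_pairing v1 v2 !mulr0.
  by rewrite gv; lra.
pose u := (m^-1 * v.1, m^-1 * v.2).
have u1 : `|u.1| + `|u.2| = 1.
  by rewrite /= !normrM (gtr0_norm (x := m^-1)) ?invr_gt0// -mulrDr mulVf// lt0r_neq0.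
have [t04 ut] := diamond_argK u1.
exists (diamond_arg u); first by rewrite /= in_itv.
have mi : 0 < m^-1 by rewrite invr_gt0.
rewrite /gam /g ut gauge_scale// gv mulr1 /= invrK -!mulrA ![v.1 * m]mulrC ![v.2 * m]mulrC.
by rewrite !mulKf ?lt0r_neq0// vE.
Qed.
End boundary_curve.

(** * One-dimensional Hausdorff measure *)

Section hausdorff.
Context {R : realType}.
Local Notation mu := (@lebesgue_measure R).
Implicit Types (A U : set (R * R)) (p q : R * R) (x y d e : R).

Lemma diam_ge0 U : (0 <= diam U)%E.
Proof. by rewrite /diam le_max lexx. Qed.

Lemma diam_ub U p q : U p -> U q -> ((enorm (p - q))%:E <= diam U)%E.
Proof.
move=> Up Uq; rewrite /diam le_max; apply/orP; right.
by apply: ereal_sup_ubound; exists (p, q).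
Qed.

Lemma diam_le U d : 0 <= d -> (forall p q, U p -> U q -> enorm (p - q) <= d) ->
  (diam U <= d%:E)%E.
Proof.
move=> d0 H; rewrite /diam ge_max lee_fin d0 /=.
by apply: ge_ereal_sup => _ [[p q] [/= Up Uq] <-]; rewrite lee_fin H.
Qed.

Lemma diam0 : diam (set0 : set (R * R)) = 0%E.
Proof. by apply/eqP; rewrite eq_le diam_ge0 andbT; apply: diam_le. Qed.

(** The infimum and the supremum of f on U differ by at most the diameter of U. *)
Lemma lipschitz_image_interval U (f : R * R -> R) :
  (forall p q, `|f p - f q| <= enorm (p - q)) ->
  exists2 I : set R, f @` U `<=` I & measurable I /\ (mu I <= diam U)%E.
Proof.
move=> fL; have [->|/set0P[p0 Up0]] := eqVneq U set0.
  by exists set0; rewrite ?image_set0// measure0 diam0.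
have [dfin|dinf] := boolP (diam U \is a fin_num); last first.
  exists setT => //; split => //.
  by move: dinf; rewrite ge0_fin_numE ?diam_ge0// ltey negbK => /eqP ->; rewrite leey.
have E := fineK dfin; set d := fine (diam U) in E.
have fd p q : U p -> U q -> f p <= f q + d.
  move=> Up Uq; rewrite -lerBlDl; apply: le_trans (ler_norm _) _.
  by apply: le_trans (fL p q) _; rewrite -lee_fin E; exact: diam_ub.
have ub : has_ubound (f @` U) by exists (f p0 + d) => _ [p Up <-]; exact: fd.
have lb : has_lbound (f @` U).
  by exists (f p0 - d) => _ [p Up <-]; rewrite lerBlDr; exact: fd.
have ne : f @` U !=set0 by exists (f p0), p0.
exists `[inf (f @` U), sup (f @` U)]%classic.
  move=> _ [p Up <-]; rewrite /= in_itv/=; apply/andP; split.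
    by apply: ge_inf => //; exists p.
  by apply: ub_le_sup => //; exists p.
split=> //; rewrite -E lebesgue_measure_itv/=; case: ifP => _; last first.
  by rewrite lee_fin -lee_fin E diam_ge0.
rewrite -EFinB lee_fin lerBlDl -lerBlDr.
apply: lb_le_inf => // _ [q Uq <-]; rewrite lerBlDr.
by apply: sup_le_ub => // _ [p Up <-]; exact: fd.
Qed.

(** A 1-Lipschitz function does not increase length: if sets cover A, the
    intervals that enclose their images cover the interval from x to y, and they are
    no longer than the diameters. *)
Lemma arclength_ge A (f : R * R -> R) x y :
  (forall p q, `|f p - f q| <= enorm (p - q)) -> x <= y ->
  (forall s, x < s < y -> exists2 p, A p & f p = s) ->
  ((y - x)%:E <= arclength A)%E.
Proof.
move=> fL xy Af; apply: le_ereal_sup_tmp.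
exists (hausdorff1_pre 1 A); first by exists 1 => /=.
apply: le_ereal_inf_tmp => _ [U [AU _] <-].
have /choice[I HI] : forall i, exists I : set R,
    [/\ f @` (U i) `<=` I, measurable I & (mu I <= diam (U i))%E].
  by move=> i; have [I h1 [h2 h3]] := lipschitz_image_interval (U i) fL; exists I.
have mxy : (mu `]x, y[%classic = (y - x)%:E)%E.
  rewrite lebesgue_measure_itv/= lte_fin; case: ltP => [_|yx]; first by rewrite EFinB.
  by have -> : x = y; [apply/eqP; rewrite eq_le xy yx|rewrite subrr].
rewrite -mxy; apply: (@le_trans _ _ (\sum_(0 <= i <oo) mu (I i))%E).
  apply: measure_sigma_subadditive => //.
  - by move=> i; case: (HI i).
  - move=> s; rewrite /= in_itv/= => /Af[p Ap <-].
    have [i _ Uip] := AU _ Ap; exists i => //.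
    by case: (HI i) => + _ _; apply; exists p.
by apply: lee_nneseries => [i _ _|i _]; [exact: measure_ge0|case: (HI i)].
Qed.

Lemma hausdorff1_pre_le A e n (C : nat -> set (R * R)) : 0 <= e ->
  (forall p, A p -> exists2 i, (i < n)%N & C i p) ->
  (forall i, (i < n)%N -> (diam (C i) <= e%:E)%E) ->
  (hausdorff1_pre e A <= \sum_(i < n) diam (C i))%E.
Proof.
move=> e0 AC Ce; pose U i := if (i < n)%N then C i else set0.
apply: ge_ereal_inf; exists (\sum_(0 <= i <oo) diam (U i))%E.
  exists U => //; split.
    by move=> p /AC[i ni Cip]; exists i => //; rewrite /U ni.
  by move=> i; rewrite /U; case: ifP => [/Ce//|_]; rewrite diam0 lee_fin.
rewrite (@nneseries_split _ _ 0 n)//; last by move=> *; exact: diam_ge0.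
rewrite eseries0 ?adde0; last first.
  by move=> i ni _; rewrite /U ltnNge; move: ni; rewrite add0n => ->; exact: diam0.
rewrite add0n big_mkord le_eqVlt; apply/orP; left; apply/eqP.
by apply: eq_bigr => i _; rewrite /U ltn_ord.
Qed.

Lemma arclength_le A (l : \bar R) :
  (forall e, 0 < e -> (hausdorff1_pre e A <= l)%E) -> (arclength A <= l)%E.
Proof. by move=> H; apply: ge_ereal_sup => _ [e e0 <-]; exact: H. Qed.

Lemma enorm_le_l1 p : enorm p <= `|p.1| + `|p.2|.
Proof.
rewrite -(@ler_pXn2r _ 2)// ?nnegrE ?enorm_ge0 ?addr_ge0// sqr_enorm.
rewrite sqrrD !real_normK ?num_real//; have : 0 <= `|p.1| * `|p.2| by rewrite mulr_ge0.
lra.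
Qed.

Lemma dot_le p q : `|p.1 * q.1 + p.2 * q.2| <= enorm p * enorm q.
Proof.
rewrite -(@ler_pXn2r _ 2)// ?nnegrE ?mulr_ge0 ?enorm_ge0//.
rewrite real_normK ?num_real// exprMn !sqr_enorm.
by have := sqr_ge0 (p.1 * q.2 - p.2 * q.1); lra.
Qed.

(** Project orthogonally onto the line through the end points of the arc: by the
    intermediate value theorem the image contains the whole chord. *)
Lemma arclength_arc_ge A (gam : R -> R * R) (s t : R) : s < t ->
  {within `[s, t], continuous (fun r => (gam r).1)} ->
  {within `[s, t], continuous (fun r => (gam r).2)} ->
  gam @` `[s, t[%classic `<=` A ->
  ((enorm (gam t - gam s))%:E <= arclength A)%E.
Proof.
move=> st c1 c2 gA; set w := gam t - gam s.
have [w0|w0] := eqVneq (enorm w) 0.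
  rewrite w0; apply: (@le_trans _ _ ((0 - 0 : R)%:E)); first by rewrite subrr.
  by apply: (@arclength_ge _ (fun _ => 0)) => // *; rewrite ?subrr ?normr0 ?enorm_ge0//; lra.
have wpos : 0 < enorm w by rewrite lt_neqAle eq_sym w0 enorm_ge0.
pose f p := (enorm w)^-1 * w.1 * p.1 + (enorm w)^-1 * w.2 * p.2.
have fB p q : f p - f q = (w.1 * (p - q).1 + w.2 * (p - q).2) / enorm w.
  by rewrite /f /=; field.
have fw : f (gam t) - f (gam s) = enorm w.
  by rewrite fB -/w -!expr2 -sqr_enorm expr2 mulfK.
rewrite -fw; have xy : f (gam s) <= f (gam t) by rewrite -subr_ge0 fw ltW.
apply: (@arclength_ge A f (f (gam s)) (f (gam t))) => //.
  move=> p q; rewrite fB normrM normfV (gtr0_norm wpos) ler_pdivrMr//.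
  by apply: le_trans (dot_le w (p - q)) _; rewrite mulrC.
move=> v /andP[sv vt].
have cf : {within `[s, t], continuous (fun r => f (gam r))}.
  by apply: within_segmentD; exact: within_segmentZ.
have [|r] := @IVT _ _ _ _ v (ltW st) cf.
  by rewrite ge_min (ltW sv) le_max (ltW vt) orbT.
rewrite in_itv/= => /andP[sr rt] frv; exists (gam r) => //.
apply: gA; exists r => //; rewrite /= in_itv/= sr lt_neqAle rt andbT.
by apply/eqP => rt'; move: vt; rewrite -frv rt' ltxx.
Qed.
End hausdorff.

(** * Boundary measures carried by chord ends *)

Section directions.
Context {R : realType}.
Local Notation mu := (@lebesgue_measure R).
Implicit Types (K A : set (R * R)) (p q c : R * R) (s x y tau V : R).

(** The lines on which [level tau] is constant are the chords of a fixed
    direction. *)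
Definition level tau p : R := p.1 - tau * p.2.
Definition lo_level tau K : R := lo (shear tau K).
Definition hi_level tau K : R := hi (shear tau K).
(** The upper end of the chord of level s, found in the sheared body and moved back
    to K. *)
Definition top_end tau K s : R * R :=
  (s + tau * top (shear tau K) s, top (shear tau K) s).
Definition bot_end tau K s : R * R :=
  (s + tau * bot (shear tau K) s, bot (shear tau K) s).

Lemma levelP tau K p : shear tau K (level tau p, p.2) <-> K p.
Proof. by rewrite /shear/= subrK -surjective_pairing. Qed.

Lemma level_in tau K p : body K -> K p -> lo_level tau K <= level tau p <= hi_level tau K.
Proof.
by move=> bK /(proj2 (levelP tau K p)) Kp; exact: (body_lo_hi (shear_body tau bK) Kp).
Qed.

Lemma level_attained tau K : body K ->
  (exists2 p, boundary K p & level tau p = lo_level tau K) /\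
  (exists2 p, boundary K p & level tau p = hi_level tau K).
Proof.
move=> bK; have bS := shear_body tau bK; have lh := lo_lt_hi bS.
split; [exists (top_end tau K (lo_level tau K))|exists (top_end tau K (hi_level tau K))];
  rewrite ?/level /= ?addrK//.
  by apply/(boundary_shear tau (_, _) bK)/top_boundary => //; rewrite lexx ltW.
by apply/(boundary_shear tau (_, _) bK)/top_boundary => //; rewrite lexx ltW.
Qed.

Lemma top_end_boundary tau K s : body K -> lo_level tau K <= s <= hi_level tau K ->
  boundary K (top_end tau K s).
Proof.
move=> bK sK; apply/(boundary_shear tau (_, _) bK)/top_boundary => //.
exact: shear_body.
Qed.

Lemma bot_end_boundary tau K s : body K -> lo_level tau K <= s <= hi_level tau K ->
  boundary K (bot_end tau K s).
Proof.
move=> bK sK; apply/(boundary_shear tau (_, _) bK)/bot_boundary => //.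
exact: shear_body.
Qed.

Lemma boundary_ends tau K p : body K -> boundary K p ->
  lo_level tau K < level tau p < hi_level tau K ->
  p = top_end tau K (level tau p) \/ p = bot_end tau K (level tau p).
Proof.
move=> bK bp pK; have bS := shear_body tau bK.
have bp' : boundary (shear tau K) (level tau p, p.2).
  by apply/(boundary_shear tau (_, _) bK); rewrite /= subrK -surjective_pairing.
have [/= E|/= E] := boundary_chord bS bp' pK; [left|right].
  by rewrite /top_end -E /level subrK -surjective_pairing.
by rewrite /bot_end -E /level subrK -surjective_pairing.
Qed.

(** The measure on the boundary obtained by transporting ds to both ends of the
    chord of level s.  Crofton's formula says that a suitable average of these
    measures over all directions is arclength. *)
Definition chord_measure tau K A : \bar R :=
  (\int[mu]_(s in `[lo_level tau K, hi_level tau K])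
    (\1_A (top_end tau K s) + \1_A (bot_end tau K s))%:E)%E.

Lemma within_segment_measurable (f : R -> R) (a b : R) :
  {within `[a, b], continuous f} -> measurable_fun `[a, b]%classic f.
Proof. by move=> cf; apply: subspace_continuous_measurable_fun. Qed.

Lemma measurable_ends tau K A : body K -> measurable A ->
  measurable_fun `[lo_level tau K, hi_level tau K]%classic
    (fun s => \1_A (top_end tau K s) + \1_A (bot_end tau K s) : R).
Proof.
move=> bK mA; have bS := shear_body tau bK.
have H (f : R -> R) : {within `[lo_level tau K, hi_level tau K], continuous f} ->
    measurable_fun `[lo_level tau K, hi_level tau K]%classic (fun s => \1_A (s + tau * f s, f s) : R).
  move=> cf; pose D := `[lo_level tau K, hi_level tau K]%classic.
  have mD : measurable D by exact: measurable_itv.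
  pose f' := f \_ D.
  have mf' : measurable_fun setT f'.
    by apply/(measurable_restrictT f mD); exact: within_segment_measurable.
  have h : measurable_fun setT (fun s => (s + tau * f' s, f' s) : (R * R)%type).
    apply: measurable_fun_pair => //.
    by apply: measurable_funD => //; exact: measurable_funM.
  apply: (eq_measurable_fun (fun s => \1_A (s + tau * f' s, f' s) : R)).
    by move=> s sD; rewrite /f' patchE sD.
  apply: measurable_funTS.
  exact: (measurableT_comp (measurable_indic (R := R) (D := setT) mA) h).
apply: measurable_funD; apply: H; [exact: top_continuous|exact: bot_continuous].
Qed.

Lemma indic_ge0 A p : 0 <= \1_A p :> R.
Proof. by rewrite indicE. Qed.

(** A boundary point strictly between the extreme levels is an end of its chord, so
    each level that is attained in A adds at least 1 to the integrand. *)
Lemma chord_measure_ge tau K A x y : body K -> measurable A ->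
  lo_level tau K <= x -> x <= y -> y <= hi_level tau K ->
  (forall s, x < s < y -> exists p, [/\ A p, boundary K p & level tau p = s]) ->
  ((y - x)%:E <= chord_measure tau K A)%E.
Proof.
move=> bK mA ax xy yb H.
have sub : `]x, y[%classic `<=` `[lo_level tau K, hi_level tau K]%classic.
  move=> s; rewrite /= !in_itv/= => /andP[h1 h2].
  by rewrite (le_trans ax (ltW h1)) (le_trans (ltW h2) yb).
apply: (@le_trans _ _ (\int[mu]_(s in `]x, y[) (\1_A (top_end tau K s) + \1_A (bot_end tau K s))%:E)%E); last first.
  apply: ge0_subset_integral => //.
  by apply/measurable_EFinP; exact: measurable_ends.
apply: (@le_trans _ _ (\int[mu]_(s in `]x, y[) (cst 1%:E s))%E).
  rewrite integral_cst// mul1e /= lebesgue_measure_itv/= lte_fin.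
  case: ltP => [_|yx]; first by rewrite EFinB.
  by have -> : x = y; [apply/eqP; rewrite eq_le xy yx|rewrite subrr].
apply: ge0_le_integral => //.
- by apply/measurable_EFinP; apply: measurable_funS sub _ => //; exact: measurable_ends.
- move=> s; rewrite /= in_itv/= => sxy; have [p [Ap bp ps]] := H _ sxy.
  have pK : lo_level tau K < level tau p < hi_level tau K.
    by rewrite ps; case/andP: sxy => h1 h2; rewrite (le_lt_trans ax h1) (lt_le_trans h2 yb).
  rewrite lee_fin; have [E|E] := boundary_ends bK bp pK; rewrite ps in E.
    by rewrite -E [\1_A p]indicE mem_set// lerDl indic_ge0.
  by rewrite -E [\1_A p]indicE mem_set// lerDr indic_ge0.
Qed.

(** The integral of F for [chord_measure]. *)
Definition end_sum tau K (F : R * R -> R) : R :=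
  (hi_level tau K - lo_level tau K) *
  mean (fun s => F (top_end tau K s) + F (bot_end tau K s)) (lo_level tau K) (hi_level tau K).

Lemma end_sum_le tau K n (A : nat -> set (R * R)) (cs : nat -> R) (F : R * R -> R) :
  body K -> (forall j, (j < n)%N -> measurable (A j)) ->
  (forall j, (j < n)%N -> 0 <= cs j) ->
  {within `[lo_level tau K, hi_level tau K],
    continuous (fun s => F (top_end tau K s) + F (bot_end tau K s))} ->
  (forall p, boundary K p -> 0 <= F p <= \sum_(j < n) cs j * \1_(A j) p) ->
  ((end_sum tau K F)%:E <= \sum_(j < n) (cs j)%:E * chord_measure tau K (A j))%E.
Proof.
move=> bK mA c0 cF HF; have lh := lo_lt_hi (shear_body tau bK).
rewrite /end_sum -integral_segmentE//.
have -> : (\sum_(j < n) (cs j)%:E * chord_measure tau K (A j) =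
  \int[mu]_(s in `[lo_level tau K, hi_level tau K])
    \sum_(j < n) (cs j * (\1_(A j) (top_end tau K s) + \1_(A j) (bot_end tau K s)))%:E)%E.
  rewrite ge0_integral_sum//.
  - apply: eq_bigr => j _; rewrite -ge0_integralZl//.
    + by apply/measurable_EFinP; apply: measurable_ends; [exact: bK|exact: (mA _ (ltn_ord j))].
    + by rewrite lee_fin c0.
  - move=> j; apply/measurable_EFinP; apply: measurable_funM => //.
    by apply: measurable_ends; [exact: bK|exact: (mA _ (ltn_ord j))].
  - by move=> j s _; rewrite lee_fin mulr_ge0 ?c0// addr_ge0// indic_ge0.
apply: ge0_le_integral => //.
- move=> s sK; rewrite lee_fin addr_ge0//.
    by case/andP: (HF _ (top_end_boundary bK sK)).
  by case/andP: (HF _ (bot_end_boundary bK sK)).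
- by apply/measurable_EFinP; exact: within_segment_measurable.
- apply: emeasurable_sum => j; apply/measurable_EFinP; apply: measurable_funM => //.
  by apply: measurable_ends; [exact: bK|exact: (mA _ (ltn_ord j))].
- move=> s sK; rewrite sumEFin lee_fin.
  under eq_bigr do rewrite mulrDr.
  rewrite big_split; apply: lerD.
    by case/andP: (HF _ (top_end_boundary bK sK)).
  by case/andP: (HF _ (bot_end_boundary bK sK)).
Qed.

(** Every chord has two ends. *)
Lemma sum_chord_measure_le tau K n (A : nat -> set (R * R)) :
  body K -> (forall j, (j < n)%N -> measurable (A j)) ->
  (forall p, boundary K p -> \sum_(j < n) \1_(A j) p <= 1 :> R) ->
  (\sum_(j < n) chord_measure tau K (A j) <= (2 * (hi_level tau K - lo_level tau K))%:E)%E.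
Proof.
move=> bK mA HA; have lh := lo_lt_hi (shear_body tau bK).
have -> : ((2 * (hi_level tau K - lo_level tau K))%:E =
    \int[mu]_(s in `[lo_level tau K, hi_level tau K]) (cst 2%:E s))%E.
  by rewrite integral_cst//= lebesgue_measure_itv/= lte_fin lh EFinM EFinB.
rewrite -ge0_integral_sum//; last first.
  by move=> j; apply/measurable_EFinP; apply: measurable_ends; [exact: bK|exact: (mA _ (ltn_ord j))].
apply: ge0_le_integral => //.
- by move=> s _; apply: sume_ge0 => j _; rewrite lee_fin addr_ge0// indic_ge0.
- apply: emeasurable_sum => j; apply/measurable_EFinP.
  by apply: measurable_ends; [exact: bK|exact: (mA _ (ltn_ord j))].
- move=> s sK; rewrite sumEFin lee_fin big_split -[2]/(1 + 1); apply: lerD; apply: HA.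
    exact: top_end_boundary.
  exact: bot_end_boundary.
Qed.

Lemma chord_measure_fin tau K A : body K -> measurable A ->
  chord_measure tau K A \is a fin_num.
Proof.
move=> bK mA; rewrite ge0_fin_numE; last first.
  by apply: integral_ge0 => s _; rewrite lee_fin addr_ge0// indic_ge0.
have := @sum_chord_measure_le tau K 1 (fun _ => A) bK (fun _ _ => mA).
rewrite !big_ord1 => /(_ _)/le_lt_trans; apply; last by rewrite ltry.
by move=> p _; rewrite big_ord1 indicE lern1 leq_b1.
Qed.
End directions.

(** * Squared distances at the chord ends *)

Section direction_variance.
Context {R : realType}.
Local Notation mu := (@lebesgue_measure R).
Implicit Types (K A : set (R * R)) (p q c : R * R) (s x y tau V : R).

Lemma shear_integral tau K (phi : R * R -> R) : body K -> measurable_fun setT phi ->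
  (forall z, 0 <= phi z) ->
  (\int[area]_(z in shear tau K) (phi (z.1 + tau * z.2, z.2))%:E =
   \int[area]_(z in K) (phi z)%:E)%E.
Proof.
move=> bK mphi phi0; rewrite integral_mkcond [RHS]integral_mkcond.
rewrite -(area_shear tau (f := (fun z => (phi z)%:E) \_ K)).
- apply: eq_integral => z _; rewrite !patchE; congr (if _ then _ else _).
- apply/(measurable_restrictT _ (body_measurable bK)).
  by apply: measurable_funTS; apply/measurable_EFinP.
- by move=> z; rewrite patchE; case: ifP => // _; rewrite lee_fin.
Qed.

Lemma shear_area tau K : body K -> area (shear tau K) = area K.
Proof.
move=> bK; have := @shear_integral tau K (cst 1) bK.
move=> /(_ (measurable_cst _)) /(_ (fun _ => ler01)).
by rewrite /= !integral_cst ?mul1e//; apply: body_measurable => //; exact: shear_body.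
Qed.

Definition sqdist c p : R := (p.1 - c.1) ^+ 2 + (p.2 - c.2) ^+ 2.

Lemma sqdist_ge0 c p : 0 <= sqdist c p.
Proof. by rewrite addr_ge0// sqr_ge0. Qed.

Lemma within_segment_ends tau K c : body K ->
  {within `[lo_level tau K, hi_level tau K], continuous (fun s => sqdist c (top_end tau K s))} /\
  {within `[lo_level tau K, hi_level tau K], continuous (fun s => sqdist c (bot_end tau K s))}.
Proof.
move=> bK; have bS := shear_body tau bK.
have H (f : R -> R) : {within `[lo_level tau K, hi_level tau K], continuous f} ->
    {within `[lo_level tau K, hi_level tau K], continuous (fun s => sqdist c (s + tau * f s, f s))}.
  move=> cf; apply: within_segmentD; apply: (within_segmentX (k := 2));
    apply: within_segmentD; try exact: within_segment_cst; last exact: cf.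
  apply: within_segmentD; last exact: within_segmentZ.
  by apply: continuous_subspaceT => x; exact: cvg_id.
by split; apply: H; [exact: top_continuous|exact: bot_continuous].
Qed.

(** Apply [chord_variance_le] to the sheared body, once for each coordinate of K:
    over there these coordinates are the forms s + tau * y and y, and neither is
    constant along the chords when tau is not 0. *)
Lemma direction_variance tau K V1 V2 c : body K -> tau != 0 -> (0 < area K)%E ->
  (forall x, (V1%:E * area K <= \int[area]_(z in K) ((z.1 - x) ^+ 2)%:E)%E) ->
  (forall x, (V2%:E * area K <= \int[area]_(z in K) ((z.2 - x) ^+ 2)%:E)%E) ->
  2 * (hi_level tau K - lo_level tau K) * (V1 + V2) <= end_sum tau K (sqdist c).
Proof.
move=> bK tau0 K0 H1 H2; have bS := shear_body tau bK.
have lh : lo_level tau K < hi_level tau K := lo_lt_hi bS.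
have S0 : (0 < area (shear tau K))%E by rewrite shear_area.
have h1 : 2 * V1 <= mean (fun s => (chord_top (shear tau K) 1 tau s - c.1) ^+ 2) (lo_level tau K) (hi_level tau K) +
    mean (fun s => (chord_bot (shear tau K) 1 tau s - c.1) ^+ 2) (lo_level tau K) (hi_level tau K).
  apply: chord_variance_le => // x; rewrite shear_area//.
  have := @shear_integral tau K (fun z => (z.1 - x) ^+ 2) bK.
  rewrite /= => E; have {}E := E _ (fun z => sqr_ge0 _).
  apply: le_trans (H1 x) _; rewrite -E; last first.
    by apply: measurable_funX; exact: measurable_funB.
  by rewrite le_eqVlt; apply/orP; left; apply/eqP; apply: eq_integral => z _; rewrite mul1r.
have h2 : 2 * V2 <= mean (fun s => (chord_top (shear tau K) 0 1 s - c.2) ^+ 2) (lo_level tau K) (hi_level tau K) +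
    mean (fun s => (chord_bot (shear tau K) 0 1 s - c.2) ^+ 2) (lo_level tau K) (hi_level tau K).
  apply: chord_variance_le => //.
  move=> x; rewrite shear_area//.
  have := @shear_integral tau K (fun z => (z.2 - x) ^+ 2) bK.
  rewrite /= => E; have {}E := E _ (fun z => sqr_ge0 _).
  apply: le_trans (H2 x) _; rewrite -E; last first.
    by apply: measurable_funX; exact: measurable_funB.
  by rewrite le_eqVlt; apply/orP; left; apply/eqP; apply: eq_integral => z _; rewrite mul0r add0r mul1r.
have [ct cb] := within_segment_ends tau c bK.
rewrite /end_sum (meanD ct cb) [2 * _]mulrC -mulrA ler_pM2l ?subr_gt0//.
have cX k (f : R -> R) (d : R) : {within `[lo_level tau K, hi_level tau K], continuous f} ->
    {within `[lo_level tau K, hi_level tau K], continuous (fun s => (f s - d) ^+ k)}.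
  by move=> cf; apply: within_segmentX; apply: within_segmentD => //; exact: within_segment_cst.
have t1 := cX 2 _ c.1 (chord_top_continuous (al := 1) (be := tau) bS).
have t2 := cX 2 _ c.2 (chord_top_continuous (al := 0) (be := 1) bS).
have b1 := cX 2 _ c.1 (chord_bot_continuous (al := 1) (be := tau) bS).
have b2 := cX 2 _ c.2 (chord_bot_continuous (al := 0) (be := 1) bS).
have Et : mean (fun s => sqdist c (top_end tau K s)) (lo_level tau K) (hi_level tau K) =
    mean (fun s => (chord_top (shear tau K) 1 tau s - c.1) ^+ 2) (lo_level tau K) (hi_level tau K) +
    mean (fun s => (chord_top (shear tau K) 0 1 s - c.2) ^+ 2) (lo_level tau K) (hi_level tau K).
  rewrite -(meanD t1 t2); apply: eq_mean => s.
  by rewrite /sqdist /top_end /chord_top /= mul1r mul0r add0r mul1r.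
have Eb : mean (fun s => sqdist c (bot_end tau K s)) (lo_level tau K) (hi_level tau K) =
    mean (fun s => (chord_bot (shear tau K) 1 tau s - c.1) ^+ 2) (lo_level tau K) (hi_level tau K) +
    mean (fun s => (chord_bot (shear tau K) 0 1 s - c.2) ^+ 2) (lo_level tau K) (hi_level tau K).
  rewrite -(meanD b1 b2); apply: eq_mean => s.
  by rewrite /sqdist /bot_end /chord_bot /= mul1r mul0r add0r mul1r.
by rewrite Et Eb; lra.
Qed.
End direction_variance.

(** * Cutting the boundary into small arcs *)

Section cells.
Context {R : realType}.
Implicit Types (K : set (R * R)) (p q : R * R) (F : R * R -> R) (s t u v x y e tau eta : R).

(** A partition of the boundary into consecutive half-open arcs A j that start at
    pt j, small enough for both coordinates and F to vary by at most eta.  The last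
    three fields are lower bounds for the length and the chord measures of an arc;
    pt j.+1 is an end of the arc A j but not one of its points, which is why chords
    and pairs of points of A j are treated apart. *)
Record boundary_cells K F eta n (A : nat -> set (R * R)) (pt : nat -> R * R) : Prop :=
  BoundaryCells {
    cells_loop : pt n = pt 0%N ;
    cells_sub : forall j, (j < n)%N -> A j `<=` boundary K ;
    cells_meas : forall j, (j < n)%N -> measurable (A j) ;
    cells_cover : forall p, boundary K p -> exists2 j, (j < n)%N & A j p ;
    cells_disj : forall p i j, (i < n)%N -> (j < n)%N -> A i p -> A j p -> i = j ;
    cells_pt : forall j, (j < n)%N -> A j (pt j) ;
    cells_small : forall j p q, (j < n)%N -> A j p -> A j q ->
      [/\ `|p.1 - q.1| <= eta, `|p.2 - q.2| <= eta & `|F p - F q| <= eta] ;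
    cells_length : forall j, (j < n)%N ->
      ((enorm (pt j.+1 - pt j))%:E <= arclength (A j))%E ;
    cells_level : forall tau j p q, (j < n)%N -> A j p -> A j q ->
      ((`|level tau p - level tau q|)%:E <= chord_measure tau K (A j))%E ;
    cells_chord : forall tau j, (j < n)%N ->
      ((`|level tau (pt j.+1) - level tau (pt j)|)%:E <= chord_measure tau K (A j))%E
  }.

(** A half-open arc is a countable union of compact arcs. *)
Lemma measurable_curve_image (gam : R -> R * R) (a b : R) :
  {within `[a, b], continuous (fun t => (gam t).1)} ->
  {within `[a, b], continuous (fun t => (gam t).2)} ->
  measurable (gam @` `[a, b[%classic).
Proof.
move=> c1 c2.
have -> : gam @` `[a, b[%classic = \bigcup_k gam @` `[a, b - k.+1%:R^-1]%classic.
  apply/seteqP; split=> [_ [t tab <-]|_ [k _ [t tab <-]]].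
    move: tab; rewrite /= in_itv/= => /andP[at_ tb].
    exists (Num.trunc (b - t)^-1) => //; exists t => //; rewrite /= in_itv/= at_/=.
    rewrite lerBrDr -lerBrDl -[leRHS]invrK lef_pV2 ?posrE ?invr_gt0 ?subr_gt0//.
    exact/ltW/truncnS_gt.
  exists t => //; move: tab; rewrite /= !in_itv/= => /andP[-> /le_lt_trans]; apply.
  by rewrite ltrBlDr ltrDl.
apply: bigcup_measurable => k _; apply: closed_measurable_plane.
apply: compact_closed; first exact: norm_hausdorff.
apply: continuous_compact; last exact: segment_compact.
have sub : `[a, b - k.+1%:R^-1]%classic `<=` `[a, b]%classic.
  by apply: subset_itvl; rewrite bnd_simp lerBlDr lerDl.
have c1' := continuous_subspaceW sub c1; have c2' := continuous_subspaceW sub c2.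
have -> : gam = fun t => ((gam t).1, (gam t).2) by apply/funext => t; rewrite -surjective_pairing.
exact: continuous_pair c1' c2'.
Qed.

Lemma level_curve_continuous (gam : R -> R * R) (a b tau : R) :
  {within `[a, b], continuous (fun t => (gam t).1)} ->
  {within `[a, b], continuous (fun t => (gam t).2)} ->
  {within `[a, b], continuous (fun t => level tau (gam t))}.
Proof.
move=> c1 c2; have := within_segmentD c1 (@within_segmentZ _ _ _ _ (- tau) c2).
rewrite (_ : (fun t => level tau (gam t)) = fun t => (gam t).1 + - tau * (gam t).2)//.
by apply/funext => t; rewrite /level mulNr.
Qed.

(** By the intermediate value theorem an arc meets every level between those of two
    of its points. *)
Lemma chord_measure_arc_ge K tau (gam : R -> R * R) (a b u v : R) : body K ->
  {within `[a, b], continuous (fun t => (gam t).1)} ->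
  {within `[a, b], continuous (fun t => (gam t).2)} ->
  (forall t, a <= t <= b -> boundary K (gam t)) ->
  a <= u <= b -> a <= v <= b ->
  ((`|level tau (gam u) - level tau (gam v)|)%:E <=
     chord_measure tau K (gam @` `[a, b[%classic))%E.
Proof.
move=> bK c1 c2 gb uab vab.
have mA := measurable_curve_image c1 c2.
wlog luv : u v uab vab / level tau (gam v) <= level tau (gam u).
  move=> H; have [h|/ltW h] := leP (level tau (gam v)) (level tau (gam u)); first exact: H.
  by rewrite distrC; exact: H.
rewrite ger0_norm ?subr_ge0//.
have lK t : a <= t <= b -> lo_level tau K <= level tau (gam t) <= hi_level tau K.
  by move=> tab; apply: level_in => //; apply: boundary_sub => //; exact: gb.
have /andP[lu _] := lK _ vab; have /andP[_ vh] := lK _ uab.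
apply: chord_measure_ge => // s /andP[s1 s2].
pose m := Num.min u v; pose M := Num.max u v.
have mM : m <= M by rewrite /m /M; case: (leP u v) => // /ltW.
have am : a <= m by rewrite /m le_min; case/andP: uab => ->; case/andP: vab => ->.
have Mb : M <= b by rewrite /M ge_max; case/andP: uab => _ ->; case/andP: vab => _ ->.
have sub : `[m, M]%classic `<=` `[a, b]%classic by apply: subset_itv; rewrite bnd_simp.
have cl := continuous_subspaceW sub (@level_curve_continuous gam a b tau c1 c2).
have [|r] := @IVT _ _ _ _ s mM cl.
  rewrite /m /M; case: (leP u v) => _; rewrite ?ge_min ?le_max ?(ltW s1) ?(ltW s2) ?orbT//=.
rewrite in_itv/= => /andP[mr rM] rs.
(* r = b would make s the level of gam u or gam v, but s is strictly between them *)
have rb : r < b.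
  rewrite lt_neqAle (le_trans rM Mb) andbT; apply/eqP => rb.
  have : r = M by apply/eqP; rewrite eq_le rM rb Mb.
  rewrite /M; case: (leP u v) => _ E; move: s1 s2; rewrite -rs E ltxx//.
exists (gam r); split => //.
- by exists r => //; rewrite /= in_itv/= (le_trans am mr).
- by apply: gb; rewrite (le_trans am mr) ltW.
Qed.

Lemma subdivision_cell (L : R) n u : 0 < L -> 0 <= u < L -> (0 < n)%N ->
  exists2 j, (j < n)%N & L / n%:R * j%:R <= u < L / n%:R * j.+1%:R.
Proof.
move=> L0 /andP[u0 uL] n0; have nR : 0 < n%:R :> R by rewrite ltr0n.
have h0 : 0 < L / n%:R by rewrite divr_gt0.
have q0 : 0 <= u / (L / n%:R) by rewrite divr_ge0// ltW.
have /andP[h1 h2] := truncn_itv q0.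
exists (Num.trunc (u / (L / n%:R))).
  rewrite -(ltr_nat R); apply: le_lt_trans h1 _.
  by rewrite ltr_pdivrMr// mulrCA divff ?lt0r_neq0// mulr1.
by move: h1 h2; rewrite ler_pdivlMr// ltr_pdivrMr// [_%:R * _]mulrC [_%:R * _]mulrC => -> ->.
Qed.

(** Cut the parameter interval of the boundary curve into equal parts, short enough
    for the uniform continuity of the two coordinates and of F. *)
Lemma boundary_cells_exist K F eta : body K -> continuous F -> 0 < eta ->
  exists n A pt, boundary_cells K F eta n A pt.
Proof.
move=> bK cF eta0; have [gam [c1 c2 g04 ginj gim]] := boundary_curve bK.
have gb t : 0 <= t <= 4 -> boundary K (gam t).
  move=> /andP[t0]; rewrite le_eqVlt => /predU1P[->|t4]; rewrite gim.
    by rewrite -g04; exists 0 => //; rewrite /= in_itv/=; apply/andP; split; lra.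
  by exists t => //; rewrite /= in_itv/= t0.
have c3 : {within `[0, 4], continuous (fun t => F (gam t))}.
  have cg : {within `[0, 4], continuous gam}.
    have -> : gam = fun t => ((gam t).1, (gam t).2) by apply/funext => t; rewrite -surjective_pairing.
    exact: continuous_pair c1 c2.
  by move=> t; apply: (continuous_comp (cg t)); exact: cF.
have [d1 d10 H1] := within_segment_unif c1 eta0.
have [d2 d20 H2] := within_segment_unif c2 eta0.
have [d3 d30 H3] := within_segment_unif c3 eta0.
pose d := Num.min d1 (Num.min d2 d3).
have d0 : 0 < d by rewrite !lt_min d10 d20 d30.
pose n := (Num.trunc (4 / d)).+1.
have nR : 0 < n%:R :> R by rewrite ltr0n.
pose h : R := 4 / n%:R; have h0 : 0 < h by rewrite divr_gt0.
have hd : h < d.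
  by rewrite ltr_pdivrMr// mulrC -ltr_pdivrMr//; exact: truncnS_gt.
pose T (j : nat) : R := h * j%:R.
have T0 j : 0 <= T j by rewrite mulr_ge0 ?ler0n ?(ltW h0).
have TS j : T j.+1 = T j + h by rewrite /T -natr1 mulrDr mulr1.
have Tn : T n = 4 by rewrite /T /h divfK// lt0r_neq0.
have Tle i j : (i <= j)%N -> T i <= T j by move=> ij; rewrite ler_wpM2l ?ler_nat ?(ltW h0).
have T4 j : (j < n)%N -> T j.+1 <= 4 by move=> jn; rewrite -Tn; exact: Tle.
have sub j : (j < n)%N -> `[T j, T j.+1]%classic `<=` `[0, 4]%classic.
  by move=> jn; apply: subset_itv; rewrite bnd_simp// T4.
have inT j t : (j < n)%N -> T j <= t < T j.+1 -> 0 <= t < 4.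
  move=> jn /andP[t1 t2]; rewrite (le_trans _ t1)//=; apply: lt_le_trans t2 _; exact: T4.
pose A j := gam @` `[T j, T j.+1[%classic.
have c1' j : (j < n)%N -> {within `[T j, T j.+1], continuous (fun t => (gam t).1)}.
  by move=> jn; apply: continuous_subspaceW c1; exact: sub.
have c2' j : (j < n)%N -> {within `[T j, T j.+1], continuous (fun t => (gam t).2)}.
  by move=> jn; apply: continuous_subspaceW c2; exact: sub.
have gbT j t : (j < n)%N -> T j <= t <= T j.+1 -> boundary K (gam t).
  move=> jn /andP[t1 t2]; apply: gb; rewrite (le_trans _ t1)//=; apply: le_trans t2 _; exact: T4.
exists n, A, (gam \o T); split.
- by rewrite /= Tn -g04 /T mulr0.
- move=> j jn _ [t tj <-]; move: tj; rewrite /= in_itv/= => /(inT _ _ jn) /andP[t0 t4].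
  by apply: gb; rewrite t0 ltW.
- by move=> j jn; apply: measurable_curve_image; [exact: c1'|exact: c2'].
- move=> p; rewrite gim => -[t]; rewrite /= in_itv/= => t04 <-.
  have [j jn tj] := @subdivision_cell 4 n t (ltr0n R 4) t04 isT.
  by exists j => //; exists t => //; rewrite /= in_itv.
- move=> p i j ni nj [u]; rewrite /= in_itv/= => ui <- [v].
  rewrite /= in_itv/= => vj /ginj; rewrite !in_itv/= => /(_ (inT _ _ nj vj) (inT _ _ ni ui)) E.
  rewrite E in vj; case/andP: ui => u1 u2; case/andP: vj => v1 v2.
  apply/eqP; rewrite eqn_leq; apply/andP; split; rewrite leqNgt; apply/negP => ij.
    by have := Tle _ _ ij; lra.
  by have := Tle _ _ ij; lra.
- by move=> j jn; exists (T j) => //; rewrite /= in_itv/= lexx TS ltrDl.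
- move=> j p q jn [u]; rewrite /= in_itv/= => uj <- [v]; rewrite /= in_itv/= => vj <-.
  have u04 : `[0, 4]%classic u.
    by have /andP[a1 a2] := inT _ _ jn uj; rewrite /= in_itv/= a1 ltW.
  have v04 : `[0, 4]%classic v.
    by have /andP[a1 a2] := inT _ _ jn vj; rewrite /= in_itv/= a1 ltW.
  have uv : `|u - v| < d.
    apply: le_lt_trans hd; rewrite ler_norml; move: uj vj; rewrite TS.
    by move=> /andP[? ?] /andP[? ?]; apply/andP; split; lra.
  move: uv; rewrite !lt_min => /and3P[uv1 uv2 uv3].
  by split; apply: ltW; [exact: H1|exact: H2|exact: H3].
- move=> j jn; apply: arclength_arc_ge; [|exact: c1'|exact: c2'|by []].
  by rewrite TS ltrDl.
- move=> tau j p q jn [u]; rewrite /= in_itv/= => /andP[u1 u2] <- [v].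
  rewrite /= in_itv/= => /andP[v1 v2] <-.
  apply: chord_measure_arc_ge => //; [exact: c1'|exact: c2'| |by rewrite u1 ltW|by rewrite v1 ltW].
  by move=> t; exact: gbT.
- move=> tau j jn.
  have jj : T j <= T j.+1 by exact: Tle.
  apply: chord_measure_arc_ge => //; [exact: c1'|exact: c2'| |by rewrite lexx jj|by rewrite lexx jj].
  by move=> t; exact: gbT.
Qed.
End cells.

(** * Chord ends against an inscribed polygon *)

Section comparison.
Context {R : realType}.
Implicit Types (K : set (R * R)) (p q c : R * R) (F : R * R -> R) (s t u v x y e tau eta : R).

(** The sequence goes from f k to f i and, being closed, also comes back. *)
Lemma loop_variation (f : nat -> R) n i k : f n = f 0%N -> (i <= n)%N -> (k <= n)%N ->
  2 * (f i - f k) <= \sum_(j < n) `|f j.+1 - f j|.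
Proof.
move=> fn i_n k_n.
have A m M : (m <= M)%N -> `|f M - f m| <= \sum_(m <= j < M) `|f j.+1 - f j|.
  by move=> mM; rewrite -(telescope_sumr _ mM); exact: ler_norm_sum.
have B m M : (m <= M)%N -> (M <= n)%N ->
    2 * `|f M - f m| <= \sum_(j < n) `|f j.+1 - f j|.
  move=> mM Mn; rewrite -(big_mkord predT (fun j => `|f j.+1 - f j|)).
  rewrite (big_cat_nat (n := m)) ?(leq_trans mM)//= (big_cat_nat (n := M) (m := m))//=.
  have := A _ _ (leq0n m); have := A _ _ mM; have := A _ _ Mn; rewrite fn.
  by have := ler_distD (f 0%N) (f m) (f M); rewrite (distrC (f m) (f M)); lra.
have [ik|/ltnW ki] := leqP i k.
  have := B _ _ ik k_n; have := ler_norm (- (f k - f i)); rewrite normrN; lra.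
have := B _ _ ki i_n; have := ler_norm (f i - f k); lra.
Qed.

Lemma sum_indic_cells K F eta n A pt (cs : nat -> R) p j :
  boundary_cells K F eta n A pt -> (j < n)%N -> A j p ->
  \sum_(i < n) cs i * \1_(A i) p = cs j.
Proof.
move=> cells jn Ajp; rewrite (bigD1 (Ordinal jn))//= big1; last first.
  move=> i ij; rewrite indicE memNset ?mulr0// => Aip.
  move/negP: ij; apply; apply/eqP/val_inj => /=.
  exact: (cells_disj cells (ltn_ord i) jn Aip Ajp).
by rewrite indicE mem_set// mulr1 addr0.
Qed.

Definition width tau K : R := hi_level tau K - lo_level tau K.

Definition cell_weight tau K (A : set (R * R)) : R := fine (chord_measure tau K A).

Lemma cell_weight_ge0 tau K A : 0 <= cell_weight tau K A.
Proof.
apply: fine_ge0; apply: integral_ge0 => s _.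
by rewrite lee_fin addr_ge0// indic_ge0.
Qed.

Section fixed_cells.
Variables (K : set (R * R)) (F : R * R -> R) (eta : R) (n : nat)
  (A : nat -> set (R * R)) (pt : nat -> R * R).
Hypotheses (bK : body K) (cells : boundary_cells K F eta n A pt).

Lemma cell_weightE tau j : (j < n)%N ->
  chord_measure tau K (A j) = (cell_weight tau K (A j))%:E.
Proof.
by move=> jn; rewrite /cell_weight fineK// chord_measure_fin//; exact: (cells_meas cells jn).
Qed.

Lemma sum_cell_weight_le tau : \sum_(j < n) cell_weight tau K (A j) <= 2 * width tau K.
Proof.
rewrite -lee_fin -sumEFin.
have <- : (\sum_(j < n) chord_measure tau K (A j) = \sum_(j < n) (cell_weight tau K (A j))%:E)%E.
  by apply: eq_bigr => j _; rewrite cell_weightE.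
apply: sum_chord_measure_le => //; first exact: (cells_meas cells).
move=> p bp; have [j jn Ajp] := cells_cover cells bp.
have := sum_indic_cells (fun _ => 1) cells jn Ajp.
by under eq_bigr do rewrite mul1r; move=> ->.
Qed.

Lemma end_sum_le_cells tau : (forall p, 0 <= F p) -> 0 <= eta ->
  {within `[lo_level tau K, hi_level tau K],
    continuous (fun s => F (top_end tau K s) + F (bot_end tau K s))} ->
  end_sum tau K F <= \sum_(j < n) (F (pt j) + eta) * cell_weight tau K (A j).
Proof.
move=> F0 eta0 cF; rewrite -lee_fin -sumEFin.
have -> : (\sum_(j < n) ((F (pt j) + eta) * cell_weight tau K (A j))%:E =
    \sum_(j < n) (F (pt j) + eta)%:E * chord_measure tau K (A j))%E.
  by apply: eq_bigr => j _; rewrite cell_weightE// EFinM.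
apply: (end_sum_le (cs := fun j => F (pt j) + eta)) => //.
- exact: (cells_meas cells).
- by move=> j _; exact: addr_ge0.
move=> p bp; rewrite F0/=; have [j jn Ajp] := cells_cover cells bp.
rewrite (sum_indic_cells (fun i => F (pt i) + eta) cells jn Ajp).
have [_ _] := cells_small cells jn Ajp (cells_pt cells jn).
by rewrite ler_norml => /andP[_]; lra.
Qed.

Lemma level_cell_small tau j p q : (j < n)%N -> A j p -> A j q ->
  `|level tau p - level tau q| <= (1 + `|tau|) * eta.
Proof.
move=> jn Ap Aq; have [h1 h2 _] := cells_small cells jn Ap Aq.
have -> : level tau p - level tau q = (p.1 - q.1) - tau * (p.2 - q.2) by rewrite /level; ring.
apply: le_trans (ler_normB _ _) _; rewrite normrM mulrDl mul1r.
by apply: lerD => //; exact: ler_wpM2l.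
Qed.

(** The cells that contain points of extreme level have marked points of nearly
    extreme level, and the polygon through the marked points is closed. *)
Lemma polygon_width_ge tau :
  2 * width tau K - 4 * ((1 + `|tau|) * eta) <=
  \sum_(j < n) `|level tau (pt j.+1) - level tau (pt j)|.
Proof.
have [[p bp pl] [q bq qh]] := level_attained tau bK.
have [i i_n Ai] := cells_cover cells bp; have [k kn Ak] := cells_cover cells bq.
have := @loop_variation (fun j => level tau (pt j)) n k i.
rewrite (cells_loop cells) => /(_ erefl (ltnW kn) (ltnW i_n)); apply: le_trans.
have := level_cell_small tau i_n Ai (cells_pt cells i_n).
have := level_cell_small tau kn Ak (cells_pt cells kn).
rewrite pl qh /width !ler_norml => /andP[? ?] /andP[? ?]; lra.
Qed.

Lemma cell_weight_chord tau j : (j < n)%N ->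
  `|level tau (pt j.+1) - level tau (pt j)| <= cell_weight tau K (A j).
Proof. by move=> jn; rewrite -lee_fin -cell_weightE//; exact: (cells_chord cells). Qed.

(** Each cell has at least the weight of its chord, and the total weight is at most
    twice the width, which is nearly reached by the chords alone.  So replacing
    weights by chords costs at most B times the small total difference. *)
Lemma end_sum_le_polygon tau B : (forall p, 0 <= F p) -> 0 <= eta ->
  (forall p, boundary K p -> F p <= B) ->
  {within `[lo_level tau K, hi_level tau K],
    continuous (fun s => F (top_end tau K s) + F (bot_end tau K s))} ->
  end_sum tau K F <=
    \sum_(j < n) F (pt j) * `|level tau (pt j.+1) - level tau (pt j)|
    + B * (4 * ((1 + `|tau|) * eta)) + eta * (2 * width tau K).
Proof.
move=> F0 eta0 FB cF; apply: le_trans (end_sum_le_cells F0 eta0 cF) _.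
under eq_bigr do rewrite mulrDl.
rewrite big_split/= -mulr_sumr; apply: lerD; last first.
  by apply: ler_wpM2l => //; exact: sum_cell_weight_le.
have h1 : \sum_(j < n) F (pt j) * cell_weight tau K (A j) <=
    \sum_(j < n) (F (pt j) * `|level tau (pt j.+1) - level tau (pt j)| +
      B * (cell_weight tau K (A j) - `|level tau (pt j.+1) - level tau (pt j)|)).
  apply: ler_sum => j _.
  have h2 : F (pt j) <= B by apply/FB/(cells_sub cells (ltn_ord j))/(cells_pt cells).
  have h3 := cell_weight_chord tau (ltn_ord j).
  have : 0 <= (B - F (pt j)) * (cell_weight tau K (A j) - `|level tau (pt j.+1) - level tau (pt j)|).
    by rewrite mulr_ge0// subr_ge0.
  by lra.
apply: le_trans h1 _; rewrite big_split/= lerD2l -mulr_sumr.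
have B0 : 0 <= B.
  have [p bp _] := (level_attained tau bK).1.
  exact: le_trans (F0 p) (FB p bp).
apply: ler_wpM2l => //; rewrite sumrB.
by have := polygon_width_ge tau; have := sum_cell_weight_le tau; lra.
Qed.
End fixed_cells.

(** Half of Cauchy's perimeter formula.  Cover the boundary by small cells: the
    diameter of a cell is at most 1 + e times a weighted sum of level oscillations,
    each level oscillation is at most a chord measure, and the chord measures of all
    the cells add up to at most twice the width. *)
Lemma arclength_boundary_le K e N (rho tau : nat -> R) : body K -> 0 <= e ->
  (forall k, (k < N)%N -> 0 < rho k) ->
  (forall z : R * R, enorm z <= (1 + e) * \sum_(k < N) rho k * `|z.1 - tau k * z.2|) ->
  (arclength (boundary K) <= ((1 + e) * \sum_(k < N) rho k * (2 * width (tau k) K))%:E)%E.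
Proof.
move=> bK e0 rho0 Hz; apply: arclength_le => d d0.
(* a cell has diameter at most d, as either coordinate varies by at most d / 2 *)
have eta0 : 0 < d / 2 by rewrite divr_gt0.
have c0 : continuous (fun _ : R * R => 0 : R) by move=> z; exact: cst_continuous.
have [n [A [pt cells]]] := boundary_cells_exist bK c0 eta0.
apply: (@le_trans _ _ (\sum_(j < n) diam (A j))%E).
  apply: hausdorff1_pre_le; first exact: ltW.
    by move=> p bp; have [j jn Aj] := cells_cover cells bp; exists j.
  move=> j jn; apply: diam_le; first exact: ltW.
  move=> p q Ap Aq; apply: le_trans (enorm_le_l1 _) _.
  by have [/= h1 h2 _] := cells_small cells jn Ap Aq; lra.
apply: (@le_trans _ _ (\sum_(j < n) ((1 + e) * \sum_(k < N) rho k * cell_weight (tau k) K (A j))%:E)%E).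
  apply: lee_sum => j _; apply: diam_le.
    rewrite mulr_ge0 ?addr_ge0// sumr_ge0// => k _.
    by rewrite mulr_ge0 ?cell_weight_ge0// ltW// rho0.
  move=> p q Ap Aq; apply: le_trans (Hz _) _.
  rewrite ler_wpM2l ?addr_ge0//; apply: ler_sum => k _.
  rewrite ler_pM2l ?rho0// -lee_fin -(cell_weightE bK cells _ (ltn_ord j)).
  have -> : (p - q).1 - tau k * (p - q).2 = level (tau k) p - level (tau k) q.
    by rewrite /level /=; ring.
  exact: (cells_level cells).
rewrite sumEFin lee_fin -mulr_sumr ler_wpM2l ?addr_ge0// exchange_big/=.
apply: ler_sum => k _; rewrite -mulr_sumr ler_pM2l ?rho0//.
exact: (sum_cell_weight_le bK cells).
Qed.
End comparison.

(** * Variance on the boundary *)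

Section boundary_variance.
Context {R : realType}.
Implicit Types (K : set (R * R)) (p q c : R * R) (x y e tau eta : R).

Lemma ler_small (x y C : R) : (forall e, 0 < e -> x <= y + e * C) -> x <= y.
Proof.
move=> H; apply/ler_addgt0Pr => e e0.
have C0 : 0 < `|C| + 1 by rewrite ltr_wpDl.
have := H (e / (`|C| + 1)); rewrite divr_gt0// => /(_ isT)/le_trans; apply.
rewrite lerD2l mulrAC ler_pdivrMr//; apply: ler_wpM2l; first exact: ltW.
by rewrite (le_trans (ler_norm _))// lerDl.
Qed.

Lemma sqdist_continuous c : continuous (sqdist c).
Proof.
have H (f : R * R -> R) (d : R) : continuous f -> continuous (fun p => (f p - d) ^+ 2).
  move=> cf p.
  have h : {for p, continuous (fun q => f q - d)}.
    by apply: continuousB; [exact: cf|exact: cst_continuous].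
  exact: (cvg_comp _ _ h (@exprn_continuous R 2 (f p - d))).
move=> p; exact: (cvgD (H fst c.1 continuous_fst2 p) (H snd c.2 continuous_snd2 p)).
Qed.

Lemma measurable_sqdist c : measurable_fun setT (sqdist c).
Proof.
by apply: measurable_funD; apply: measurable_funX; exact: measurable_funB.
Qed.

Lemma sqdist_bounded K c : body K ->
  exists B, forall p, boundary K p -> sqdist c p <= B.
Proof.
move=> bK; have [cK _ _] := bK.
have [q _ qmax] := compact_EVT_max (body_nonempty bK) cK
  (continuous_subspaceT (@sqdist_continuous c)).
by exists (sqdist c q) => p /(boundary_sub bK) Kp; apply: qmax; rewrite inE.
Qed.

(** The sum is a Riemann sum for the integral: on each cell the integrand varies by
    at most eta, and beta has total mass 1. *)
Lemma sum_cells_integral K c eta n A pt (beta : probability (R * R)%type R) (M : R) :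
  0 <= eta -> boundary_cells K (sqdist c) eta n A pt ->
  (\int[beta]_z (sqdist c z)%:E = M%:E)%E ->
  \sum_(j < n) sqdist c (pt j) * fine (beta (A j)) <= M + eta.
Proof.
move=> eta0 cells HM.
have mA (j : 'I_n) : measurable (A j) := cells_meas cells (ltn_ord j).
have mF : measurable_fun setT (fun z => (sqdist c z)%:E : \bar R).
  by apply/measurable_EFinP; exact: measurable_sqdist.
rewrite -lee_fin EFinD -HM -sumEFin.
have -> : eta%:E = (\int[beta]_z (cst eta%:E z))%E.
  by rewrite integral_cst//= probability_setT mule1.
rewrite -ge0_integralD//; last by move=> z _; rewrite lee_fin sqdist_ge0.
have -> : (\sum_(j < n) (sqdist c (pt j) * fine (beta (A j)))%:E =
    \int[beta]_z \sum_(j < n) (sqdist c (pt j) * \1_(A j) z)%:E)%E.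
  rewrite ge0_integral_sum//; last 2 first.
  - by move=> j; apply/measurable_EFinP; apply: measurable_funM.
  - by move=> j z _; rewrite lee_fin mulr_ge0 ?sqdist_ge0 ?indic_ge0.
  apply: eq_bigr => j _; rewrite EFinM fineK ?fin_num_measure//.
  under eq_integral do rewrite EFinM.
  rewrite ge0_integralZl//; last 2 first.
  - by apply/measurable_EFinP; exact: (measurable_indic (mA j)).
  - by rewrite lee_fin sqdist_ge0.
  by rewrite integral_indic// setIT.
apply: ge0_le_integral => //.
- by move=> z _; apply: sume_ge0 => j _; rewrite lee_fin mulr_ge0 ?sqdist_ge0 ?indic_ge0.
- by apply: emeasurable_sum => j; apply/measurable_EFinP; apply: measurable_funM.
- exact: emeasurable_funD.
move=> z _; rewrite sumEFin -EFinD lee_fin.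
have [[j jn Aj]|nA] := pselect (exists2 j, (j < n)%N & A j z).
  rewrite (sum_indic_cells (fun j => sqdist c (pt j)) cells jn Aj).
  have [_ _] := cells_small cells jn Aj (cells_pt cells jn).
  by rewrite ler_norml => /andP[? _]; lra.
rewrite big1 => [|j _]; first exact: (addr_ge0 (sqdist_ge0 c z) eta0).
by rewrite indicE memNset ?mulr0// => Aj; apply: nA; exists j.
Qed.

(** With V = V1 + V2 and F = sqdist c, the length is at most 1 + e times the sum of
    rho k * 2 * width k ([arclength_boundary_le]), and in each direction
    2 * width k * V is nearly at most the sum of F (p_j) times the level difference
    of p_j and p_(j+1) ([direction_variance], [end_sum_le_polygon]).  Summed over
    the directions these level differences are at most |p_(j+1) - p_j|, hence at
    most the length of the arc, which is L times its mass for beta. *)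
Lemma boundary_variance_ge K V1 V2 c (beta : probability (R * R)%type R) (L M : R) :
  body K -> (0 < area K)%E -> 0 <= V1 + V2 ->
  (forall x, (V1%:E * area K <= \int[area]_(z in K) ((z.1 - x) ^+ 2)%:E)%E) ->
  (forall x, (V2%:E * area K <= \int[area]_(z in K) ((z.2 - x) ^+ 2)%:E)%E) ->
  0 < L -> arclength (boundary K) = L%:E ->
  (forall A, measurable A -> A `<=` boundary K -> (L%:E * beta A = arclength A)%E) ->
  (\int[beta]_z (sqdist c z)%:E = M%:E)%E ->
  V1 + V2 <= M.
Proof.
move=> bK K0 V0 H1 H2 L0 HL Hbeta HM.
have M0 : 0 <= M by rewrite -lee_fin -HM; apply: integral_ge0 => z _; rewrite lee_fin sqdist_ge0.
have [B HB] := sqdist_bounded c bK.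
apply: (@ler_small _ _ M) => e e0.
have [N [rho [tau [rt Hz]]]] := @euclidean_norm_zonotope R e e0.
have rho0 k : (k < N)%N -> 0 < rho k by move=> /rt[].
have LW := @arclength_boundary_le R K e N rho tau bK (ltW e0) rho0 (fun z => (Hz z).2).
rewrite HL lee_fin in LW.
rewrite -(ler_pM2r L0).
pose C := \sum_(k < N) rho k * (B * (4 * (1 + `|tau k|)) + 2 * width (tau k) K).
apply: (@ler_small _ _ ((1 + e) * (L + C))) => eta eta0.
have [n [A [pt cells]]] := boundary_cells_exist bK (sqdist_continuous (c := c)) eta0.
pose D k j := `|level (tau k) (pt j.+1) - level (tau k) (pt j)|.
have e1 : 0 <= 1 + e by rewrite addr_ge0// ltW.
(* the error terms of [end_sum_le_polygon] add up to eta * C *)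
have S1 : \sum_(k < N) rho k * (2 * width (tau k) K) * (V1 + V2) <=
    \sum_(j < n) sqdist c (pt j) * \sum_(k < N) rho k * D k j + eta * C.
  have -> : \sum_(j < n) sqdist c (pt j) * \sum_(k < N) rho k * D k j =
      \sum_(k < N) rho k * \sum_(j < n) sqdist c (pt j) * D k j.
    under eq_bigr do rewrite mulr_sumr.
    rewrite exchange_big/=; apply: eq_bigr => k _; rewrite mulr_sumr.
    by apply: eq_bigr => j _; rewrite mulrCA.
  rewrite /C mulr_sumr -big_split/=; apply: ler_sum => k _.
  have [rk tk] := rt k (ltn_ord k).
  have h1 := direction_variance c bK tk K0 H1 H2.
  have [ct cb] := within_segment_ends (tau k) c bK.
  have h2 := end_sum_le_polygon bK cells (sqdist_ge0 c) (ltW eta0) HB (within_segmentD ct cb).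
  rewrite -mulrA [eta * _]mulrCA -mulrDr ler_pM2l//.
  apply: le_trans h1 (le_trans h2 _).
  by rewrite -addrA lerD2l; lra.
have S2 : \sum_(j < n) sqdist c (pt j) * \sum_(k < N) rho k * D k j <= L * (M + eta).
  apply: (@le_trans _ _ (L * \sum_(j < n) sqdist c (pt j) * fine (beta (A j)))); last first.
    by rewrite ler_pM2l//; exact: (sum_cells_integral (ltW eta0) cells HM).
  rewrite mulr_sumr; apply: ler_sum => j _; rewrite mulrCA.
  apply: ler_wpM2l; first exact: sqdist_ge0.
  have [h3 _] := Hz (pt j.+1 - pt j).
  apply: (@le_trans _ _ (enorm (pt j.+1 - pt j))).
    apply: le_trans h3; rewrite le_eqVlt; apply/orP; left; apply/eqP; apply: eq_bigr => k _.
    by rewrite /D /level /=; congr (_ * `|_|); ring.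
  have mAj := cells_meas cells (ltn_ord j).
  rewrite -lee_fin EFinM fineK ?fin_num_measure// Hbeta//; last exact: (cells_sub cells).
  exact: (cells_length cells).
rewrite -mulr_suml in S1.
apply: (@le_trans _ _ ((1 + e) * (L * (M + eta) + eta * C))); last lra.
apply: (@le_trans _ _ ((1 + e) * ((\sum_(k < N) rho k * (2 * width (tau k) K)) * (V1 + V2)))).
  by rewrite mulrA mulrC; apply: ler_wpM2r.
by apply: ler_wpM2l => //; apply: le_trans S1 _; rewrite lerD2r.
Qed.
End boundary_variance.

(** * Variance and independent copies *)

Section probability_moments.
Context {R : realType}.
Implicit Types (K : set (R * R)) (c : R * R) (x y : R).

Lemma integral_full_measure (mu : probability (R * R)%type R) K (f : R * R -> \bar R) :
  measurable K -> mu K = 1%E -> measurable_fun setT f -> (forall z, (0 <= f z)%E) ->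
  (\int[mu]_z f z = \int[mu]_(z in K) f z)%E.
Proof.
move=> mK muK mf f0.
have NK : mu (~` K) = 0%E by rewrite probability_setC// muK subee.
by rewrite (ge0_negligible_integral (measurableC mK) measurableT mf _ NK)// setTD setCK.
Qed.

(** Steiner's parallel axis formula: m and V are the mean and the variance of f,
    which is square integrable because it is bounded on K. *)
Lemma parallel_axis (mu : probability (R * R)%type R) K (f : R * R -> R) (B : R) :
  measurable K -> mu K = 1%E -> measurable_fun setT f ->
  (forall z, K z -> `|f z| <= B) ->
  exists m V, forall x, (\int[mu]_z ((f z - x) ^+ 2)%:E = (V + (m - x) ^+ 2)%:E)%E.
Proof.
move=> mK muK mf fB.
have mfK : measurable_fun K f by apply: measurable_funTS.
have muKoo : (mu K < +oo)%E by rewrite muK ltry.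
have if1 : mu.-integrable K (EFin \o f).
  apply: measurable_bounded_integrable => //.
  exists B; split; first exact: num_real.
  by move=> M BM z Kz; apply: le_trans (fB z Kz) (ltW BM).
have if2 : mu.-integrable K (EFin \o (fun z => f z ^+ 2)).
  apply: measurable_bounded_integrable => //.
    exact: measurable_funX.
  exists (B ^+ 2); split; first exact: num_real.
  move=> M BM z Kz; apply: le_trans (ltW BM); rewrite /= normrX.
  by rewrite lerXn2r ?nnegrE// ?fB// (le_trans _ (fB z Kz)).
have ic x : mu.-integrable K (EFin \o (fun _ : R * R => x)).
  apply: measurable_bounded_integrable => //.
  exists `|x|; split; first exact: num_real.
  by move=> M BM z Kz; exact: ltW.
have Ic x : \int[mu]_(z in K) x = x.
  by rewrite Rintegral_cst//= muK mulr1.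
exists (\int[mu]_(z in K) f z), (\int[mu]_(z in K) f z ^+ 2 - (\int[mu]_(z in K) f z) ^+ 2) => x.
rewrite (integral_full_measure mK muK); last 2 first.
- by apply/measurable_EFinP; apply: measurable_funX; exact: measurable_funB.
- by move=> z; rewrite lee_fin sqr_ge0.
have ilin : mu.-integrable K (EFin \o (fun z => (2 * x) * f z)).
  rewrite (_ : EFin \o _ = (fun z => (2 * x)%:E * (f z)%:E)%E); last first.
    by apply/funext => z /=; rewrite EFinM.
  exact: integrableZl.
have i1 : mu.-integrable K (EFin \o (fun z => f z ^+ 2 - (2 * x) * f z)).
  rewrite (_ : EFin \o _ = (fun z => (f z ^+ 2)%:E - ((2 * x) * f z)%:E)%E); last first.
    by apply/funext => z /=; rewrite EFinB.
  exact: integrableB.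
transitivity (\int[mu]_(z in K) ((f z ^+ 2 - (2 * x) * f z) + x ^+ 2)%:E)%E.
  by apply: eq_integral => z _; congr EFin; ring.
have i2 : mu.-integrable K (EFin \o (fun z => (f z ^+ 2 - (2 * x) * f z) + x ^+ 2)).
  rewrite (_ : EFin \o _ = (fun z => (f z ^+ 2 - (2 * x) * f z)%:E + (x ^+ 2)%:E)%E); last first.
    by apply/funext => z /=; rewrite EFinD.
  by apply: integrableD => //; exact: (ic (x ^+ 2)).
rewrite -[LHS]fineK; last exact: (integrable_fin_num mK i2).
congr EFin; rewrite -/(Rintegral mu K (fun z => (f z ^+ 2 - (2 * x) * f z) + x ^+ 2)).
rewrite RintegralD// RintegralB// RintegralZl// Ic; ring.
Qed.

End probability_moments.

Section independent_pairs.
Context {R : realType} d (T : measurableType d) (P : probability T R).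
Variables (X Y : {RV P >-> (R * R)%type}) (K : set (R * R)) (B : R).
Hypotheses (mK : measurable K) (XK : distribution P X K = 1%E)
  (KB : forall z, K z -> `|z.1| <= B /\ `|z.2| <= B)
  (XY : forall A, measurable A -> distribution P Y A = distribution P X A)
  (indep : independent X Y).

Let mpair : measurable_fun setT (fun t => (X t, Y t)).
Proof. exact: measurable_fun_pair. Qed.

Let mpair_mixin := isMeasurableFun.Build _ _ _ _ _ mpair.
Let Z : {RV P >-> ((R * R) * (R * R))%type} := HB.pack (fun t => (X t, Y t)) mpair_mixin.

(** Independence is the product rule on rectangles, and it determines the joint law
    as the product of the two laws. *)
Lemma integral_independent (f : (R * R) * (R * R) -> R) :
  measurable_fun setT f -> (forall z, 0 <= f z) ->
  (\int[P]_t (f (X t, Y t))%:E =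
   \int[distribution P X]_x \int[distribution P X]_y (f (x, y))%:E)%E.
Proof.
move=> mf f0; pose mu := distribution P X.
have mfE : measurable_fun setT (fun z => (f z)%:E : \bar R) by apply/measurable_EFinP.
have f0E z : (0 <= (f z)%:E)%E by rewrite lee_fin.
transitivity (\int[distribution P Z]_z (f z)%:E)%E.
  by rewrite ge0_integral_distribution.
transitivity (\int[(mu \x mu)%E]_z (f z)%:E)%E; last first.
  exact: (@fubini_tonelli1 _ _ _ _ _ mu mu (fun z => (f z)%:E)).
apply: eq_measure_integral => A mA _; apply/esym.
apply: product_measure_unique => // A1 A2 mA1 mA2.
have E2 : mu A2 = distribution P Y A2 by rewrite XY.
by move: E2 => /(congr1 (fun z => mu A1 * z)%E) => E2; apply: etrans (esym E2); exact: indep.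
Qed.

(** For a fixed value x of X, the mean of |x - Y|^2 is the variance plus the squared
    distance from x to the mean point, whose mean is again the variance. *)
Lemma expectation_sqdist (m1 V1 m2 V2 : R) :
  (forall x, (\int[distribution P X]_z ((z.1 - x) ^+ 2)%:E = (V1 + (m1 - x) ^+ 2)%:E)%E) ->
  (forall x, (\int[distribution P X]_z ((z.2 - x) ^+ 2)%:E = (V2 + (m2 - x) ^+ 2)%:E)%E) ->
  ('E_P[fun t => (enorm (X t - Y t) ^+ 2)%R] = (2 * (V1 + V2))%:E)%E /\
  (forall c, \int[distribution P X]_z (sqdist c z)%:E = (V1 + V2 + sqdist c (m1, m2))%:E)%E.
Proof.
move=> H1 H2.
have S c : (\int[distribution P X]_z (sqdist c z)%:E = (V1 + V2 + sqdist c (m1, m2))%:E)%E.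
  under eq_integral do rewrite /sqdist EFinD.
  rewrite ge0_integralD//; last 4 first.
  - by move=> z _; rewrite lee_fin sqr_ge0.
  - by apply/measurable_EFinP; apply: measurable_funX; exact: measurable_funB.
  - by move=> z _; rewrite lee_fin sqr_ge0.
  - by apply/measurable_EFinP; apply: measurable_funX; exact: measurable_funB.
  by rewrite H1 H2 -EFinD; congr EFin; rewrite /sqdist /=; ring.
split=> //; rewrite unlock.
pose f (z : (R * R) * (R * R)) : R := (z.2.1 - z.1.1) ^+ 2 + (z.2.2 - z.1.2) ^+ 2.
transitivity (\int[P]_t (f (X t, Y t))%:E)%E.
  by apply: eq_integral => t _; rewrite sqr_enorm /f /=; congr EFin; ring.
rewrite integral_independent; last 2 first.
- by apply: measurable_funD; apply: measurable_funX; apply: measurable_funB;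
    apply: measurableT_comp.
- by move=> z; rewrite /f addr_ge0 ?sqr_ge0.
transitivity (\int[distribution P X]_x ((V1 + V2)%:E + (sqdist (m1, m2) x)%:E))%E.
  apply: eq_integral => x _; have := S x; rewrite /sqdist /f /= => ->.
  by rewrite -EFinD; congr EFin; ring.
have V0 : 0 <= V1 + V2.
  have := S (m1, m2); rewrite {2}/sqdist /= !subrr expr0n/= !addr0 => h.
  by rewrite -lee_fin -h; apply: integral_ge0 => z _; rewrite lee_fin sqdist_ge0.
rewrite ge0_integralD//; last 2 first.
- by move=> z _; rewrite lee_fin sqdist_ge0.
- by apply/measurable_EFinP; exact: measurable_sqdist.
rewrite S integral_cst//= probability_setT mule1 /sqdist /= !subrr expr0n/= !addr0.
by rewrite -EFinD; congr EFin; ring.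
Qed.
End independent_pairs.

(** * Uniform laws *)

Section uniform_laws.
Context {R : realType}.
Implicit Types (K : set (R * R)) (x : R).

Lemma dive_self_eq1 (x : \bar R) : (x / x = 1)%E -> exists2 r : R, r != 0 & x = r%:E.
Proof.
case: x => [r| |].
- have [->|r0] := eqVneq r 0; last by exists r.
  by rewrite mul0e => /esym/eqP; rewrite onee_eq0.
- by rewrite invey mule0 => /esym/eqP; rewrite onee_eq0.
- by rewrite inveNy mulNyNy.
Qed.

(** The whole space has probability 1, so the total mass of mu on D divided by itself
    is 1; this fails for 0 and for infinite masses. *)
Lemma uniform_total d (T : measurableType d) (P : probability T R)
    (mu : set (R * R) -> \bar R) (D : set (R * R)) (X : {RV P >-> (R * R)%type}) :
  uniform_on mu D X -> exists2 r : R, r != 0 & mu D = r%:E.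
Proof.
move=> hX; apply: dive_self_eq1.
by have := hX setT measurableT; rewrite probability_setT setTI.
Qed.

Lemma uniform_supported d (T : measurableType d) (P : probability T R)
    (mu : set (R * R) -> \bar R) (D K : set (R * R)) (X : {RV P >-> (R * R)%type}) :
  uniform_on mu D X -> measurable K -> D `<=` K -> distribution P X K = 1%E.
Proof.
move=> hX mK DK; have := hX setT measurableT; rewrite probability_setT setTI => ->.
by rewrite hX// setIC setIidl.
Qed.

Lemma arclength_ge0 (A : set (R * R)) : (0 <= arclength A)%E.
Proof.
have := @arclength_ge R A (fun _ => 0) 0 0; rewrite subrr; apply=> //.
  by move=> p q; rewrite normr0 enorm_ge0.
by move=> s /andP[s0 /(lt_trans s0)]; rewrite ltxx.
Qed.

Lemma body_bounded K : body K ->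
  exists B, forall z : R * R, K z -> `|z.1| <= B /\ `|z.2| <= B.
Proof.
move=> [cK _ _]; have [M [_ HM]] := compact_bounded cK.
exists (`|M| + 1) => z Kz; have : `|z| <= `|M| + 1.
  by apply: HM => //; rewrite (le_lt_trans (ler_norm _))// ltrDl.
by rewrite prod_normE ge_max => /andP.
Qed.

(** On the subsets of K the law of X is the area divided by a. *)
Lemma uniform_area_integral d (T : measurableType d) (P : probability T R) K
    (X : {RV P >-> (R * R)%type}) (a : R) (phi : R * R -> R) :
  body K -> uniform_on area K X -> area K = a%:E -> 0 < a ->
  measurable_fun setT phi -> (forall z, 0 <= phi z) ->
  (a%:E * \int[distribution P X]_z (phi z)%:E = \int[area]_(z in K) (phi z)%:E)%E.
Proof.
move=> bK hX aE a0 mphi phi0; have mK := body_measurable bK.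
have mphiE : measurable_fun setT (fun z => (phi z)%:E : \bar R) by apply/measurable_EFinP.
have phi0E z : (0 <= (phi z)%:E)%E by rewrite lee_fin.
have XK : distribution P X K = 1%E := uniform_supported hX mK (@subset_refl _ K).
rewrite (integral_full_measure mK XK)//.
have k0 : 0 <= a^-1 by rewrite invr_ge0 ltW.
rewrite (eq_measure_integral (mscale (NngNum k0) area)); last first.
  move=> A mA AK; rewrite /= /mscale/= hX// aE inver gt_eqF// muleC.
  by rewrite setIidl.
rewrite ge0_integral_mscale//; last exact: measurable_funTS.
by rewrite /= muleA -EFinM divff ?mul1e// gt_eqF.
Qed.
End uniform_laws.

Theorem corollary3p3 (R : realType) (K : set (R * R)) (hK : convex_body K)
    (d : measure_display) (T : measurableType d) (P : probability T R)
    (X1 X2 : {RV P >-> (R * R)%type})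
    (hX1 : uniform_on area K X1) (hX2 : uniform_on area K X2)
    (hX : independent X1 X2)
    (d' : measure_display) (T' : measurableType d') (Q : probability T' R)
    (B1 B2 : {RV Q >-> (R * R)%type})
    (hB1 : uniform_on arclength (boundary K) B1)
    (hB2 : uniform_on arclength (boundary K) B2)
    (hB : independent B1 B2) :
  ('E_P[fun t => (enorm (X1 t - X2 t) ^+ 2)%R]
    <= 'E_Q[fun t => (enorm (B1 t - B2 t) ^+ 2)%R])%E.
Proof.
have bK := convex_body_body hK; have mK := body_measurable bK.
have [B KB] := body_bounded bK.
have mf1 : measurable_fun setT (fst : R * R -> R) by [].
have mf2 : measurable_fun setT (snd : R * R -> R) by [].
have [a a0 aE] := uniform_total hX1.
have a_gt0 : 0 < a by rewrite lt_neqAle eq_sym a0 -lee_fin -aE measure_ge0.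
have [L L0 LE] := uniform_total hB1.
have L_gt0 : 0 < L by rewrite lt_neqAle eq_sym L0 -lee_fin -LE arclength_ge0.
have XK := uniform_supported hX1 mK (@subset_refl _ K).
have BK := uniform_supported hB1 mK (boundary_sub bK).
have KB1 z : K z -> `|z.1| <= B by move=> /KB[].
have KB2 z : K z -> `|z.2| <= B by move=> /KB[].
have [m1 [V1 HV1]] := parallel_axis mK XK mf1 KB1.
have [m2 [V2 HV2]] := parallel_axis mK XK mf2 KB2.
have [n1 [W1 HW1]] := parallel_axis mK BK mf1 KB1.
have [n2 [W2 HW2]] := parallel_axis mK BK mf2 KB2.
have X21 A : measurable A -> distribution P X2 A = distribution P X1 A.
  by move=> mA; rewrite hX1// hX2.
have B21 A : measurable A -> distribution Q B2 A = distribution Q B1 A.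
  by move=> mA; rewrite hB1// hB2.
have [-> _] := expectation_sqdist X21 hX HV1 HV2.
have [-> HS] := expectation_sqdist B21 hB HW1 HW2.
have V_ge0 (mu : probability (R * R)%type R) (f : R * R -> R) m V :
    (forall x, (\int[mu]_z ((f z - x) ^+ 2)%:E = (V + (m - x) ^+ 2)%:E)%E) -> 0 <= V.
  move=> /(_ m); rewrite subrr expr0n/= addr0 => h.
  by rewrite -lee_fin -h; apply: integral_ge0 => z _; rewrite lee_fin sqr_ge0.
have VA (f : R * R -> R) m V : measurable_fun setT f ->
    (forall x, (\int[distribution P X1]_z ((f z - x) ^+ 2)%:E = (V + (m - x) ^+ 2)%:E)%E) ->
    forall x, (V%:E * area K <= \int[area]_(z in K) ((f z - x) ^+ 2)%:E)%E.
  move=> mf HV x; rewrite -(uniform_area_integral bK hX1 aE a_gt0); last 2 first.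
  - by apply: measurable_funX; exact: measurable_funB.
  - by move=> z; exact: sqr_ge0.
  by rewrite HV aE muleC -!EFinM lee_fin ler_pM2l// lerDl sqr_ge0.
have HM := HS (n1, n2); rewrite {2}/sqdist /= !subrr expr0n/= !addr0 in HM.
have VW : V1 + V2 <= W1 + W2.
  apply: (@boundary_variance_ge R K V1 V2 (n1, n2) (distribution Q B1) L) => //.
  - by rewrite aE lte_fin.
  - by apply: addr_ge0; [exact: V_ge0 HV1|exact: V_ge0 HV2].
  - exact: VA mf1 HV1.
  - exact: VA mf2 HV2.
  - move=> A mA AK; have := hB1 A mA.
    rewrite (setIidl AK) LE inver (negbTE L0) => /(congr1 (fun y => L%:E * y)%E) E.
    by apply: etrans E _; rewrite muleCA -EFinM divff// mule1.
by rewrite lee_fin; lra.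
Qed.
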